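(* Let $\Omega\subset\mathbb R^d$ be a nonempty, bounded open set of Lebesgue measure $M>0$ and let $K\subset\mathbb R^d$ be compact. Let $(f_n)$ be a sequence of m-oscillating functions $f_n\colon\Omega\to K$ and assume that the sequence $(Jt_{f_n})$ of their total slopes is monotonic. Then the sequence $(\rho_n)$ of Young measures associated with the functions $f_n$ is weakly convergent (in the Banach space $\mathrm{rca}(K)$) to a homogeneous Young measure $\rho$. Moreover, $\rho$ has a density (with respect to the Lebesgue measure $\mu$ on $K$) which is equal to the weak $L^1(K)$ limit of the sequence $(u_n)$ of densities of the Young measures associated with the functions $f_n$.
   Context: m-oscillating functions: consider a partition of $\Omega$ into at most countably many pairwise disjoint open subsets $\Omega_1,\Omega_2,\dots$ with $\bigcup_i\overline{\Omega}_i=\overline{\Omega}$, and functions $f_i\colon\Omega_i\to K\subset\mathbb R^d$ with inverses $f_i^{-1}$ that are continuously differentiable on $f_i(\Omega_i)$, such that $K_i:=\overline{f_i(\Omega_i)}$ is compact; $J_{f_i^{-1}}$ denotes the Jacobian (determinant) of $f_i^{-1}$. A function $f$ on $\Omega$, with $\overline{f(\Omega)}$ compact, is m-oscillating if it is of the form $f(x)=\sum_i f_i(x)\chi_{\Omega_i}(x)$. The partition may depend on the function. The total slope of such $f$ is $Jt_f(y):=\sum_{i:\,y\in K_i}|J_{f_i^{-1}}(y)|$. Monotonicity of $(Jt_{f_n})$ means that this sequence of functions on $K$ is nondecreasing or nonincreasing in $n$. $\mathrm{rca}(K)$ is the Banach space of regular countably additive scalar measures on the Borel $\sigma$-algebra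 of $K$ with the total variation norm; weak convergence of measures means convergence in the weak topology of this Banach space. A homogeneous Young measure is a constant map from $\Omega$ to probability measures on $K$, identified with its value. With $d\lambda(x):=\frac1M dx$ on $\Omega$, the homogeneous Young measure associated with a Borel function $f\colon\Omega\to K$ is the image measure $\lambda\circ f^{-1}$; the Young measure associated with an m-oscillating function $f$ is homogeneous, with density $\frac1M Jt_f$ with respect to $\mu$. *)

(* Defs.v *)
From HB Require Import structures.
From mathcomp Require Import all_boot all_order all_algebra.
From mathcomp Require Import all_classical all_reals all_analysis.
From mathcomp Require Import measurable_realfun.
Set Implicit Arguments.
Unset Strict Implicit.
Unset Printing Implicit Defensive.
Import Order.TTheory GRing.Theory Num.Theory.
Import numFieldNormedType.Exports.
Local Open Scope classical_set_scope.
Local Open Scope ring_scope.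

(* d-dimensional Lebesgue measure on the Borel sets of 'rV[R]_d: the d-fold
   product of lebesgue_measure, built on tuples and carried over to row
   vectors (see lebesgue_rV_box). *)
Section lebesgue_tuple.
Context {R : realType}.
Local Notation RT n := (n.-tuple (measurableTypeR R)).

Definition tcons n (p : measurableTypeR R * RT n) : RT n.+1 :=
  [tuple of p.1 :: p.2].

Definition tuncons n (t : RT n.+1) : measurableTypeR R * RT n :=
  (thead t, [tuple of behead t]).

Lemma tconsK n : cancel (@tcons n) (@tuncons n).
Proof.
by move=> [x t]; rewrite /tuncons /tcons/= theadE; congr pair; apply/val_inj.
Qed.

Lemma measurable_tcons n : measurable_fun setT (@tcons n).
Proof. exact: measurable_cons. Qed.

Lemma measurable_tuncons n : measurable_fun setT (@tuncons n).
Proof.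
by apply/measurable_fun_pair; [exact: measurable_tnth|exact: measurable_behead].
Qed.

Section lebesgue_tcons.
Variables (n : nat) (mu : {sigma_finite_measure set (RT n) -> \bar R}).

Definition lebesgue_tcons : set (RT n.+1) -> \bar R :=
  pushforward (lebesgue_measure \x mu)%E (@tcons n).

Let tcons0 : lebesgue_tcons set0 = 0%E.
Proof. by rewrite /lebesgue_tcons /pushforward preimage_set0 measure0. Qed.

Let tcons_ge0 A : (0 <= lebesgue_tcons A)%E.
Proof. by rewrite /lebesgue_tcons /pushforward; exact: measure_ge0. Qed.

Let tcons_sigma_additive : semi_sigma_additive lebesgue_tcons.
Proof.
move=> F mF tF mUF; rewrite /lebesgue_tcons /pushforward preimage_bigcup.
have mpre A : measurable A -> measurable (@tcons n @^-1` A).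
  by move=> mA; rewrite -[X in measurable X]setTI; exact: measurable_tcons.
apply: measure_semi_sigma_additive.
- by move=> k; exact: mpre.
- apply/trivIsetP => i j _ _ ij; rewrite -preimage_setI.
  by move/trivIsetP : tF => /(_ _ _ Logic.I Logic.I ij) ->; rewrite preimage_set0.
- by rewrite -preimage_bigcup; exact: mpre.
Qed.

HB.instance Definition _ := isMeasure.Build _ _ _ lebesgue_tcons
  tcons0 tcons_ge0 tcons_sigma_additive.

Let tcons_sigma_finite : sigma_finite setT lebesgue_tcons.
Proof.
have /sigma_finiteP[F [TF ndF Foo]] := sigma_finiteT (@lebesgue_measure R).
have /sigma_finiteP[G [TG ndG Goo]] := sigma_finiteT mu.
exists (fun k => @tuncons n @^-1` (F k `*` G k)).
  rewrite -preimage_bigcup (_ : \bigcup_k _ = setT) ?preimage_setT//.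
  rewrite -setXTT TF TG predeqE => -[x y]; split.
    by move=> [k _ []/= ? ?]; split; exists k.
  move=> [/= [k _ Fkx] [l _ Gly]]; exists (maxn k l) => //; split.
  - by move: x Fkx; exact/subsetPset/ndF/leq_maxl.
  - by move: y Gly; exact/subsetPset/ndG/leq_maxr.
move=> k; have [mF Fk] := Foo k; have [mG Gk] := Goo k; split.
  rewrite -[X in measurable X]setTI; apply: measurable_tuncons => //.
  exact: measurableX.
rewrite /lebesgue_tcons /pushforward -comp_preimage.
rewrite (_ : _ \o _ = id) ?preimage_id; last first.
  by apply/funext => p; exact: tconsK.
by rewrite product_measure1E// lte_mul_pinfty// ge0_fin_numE.
Qed.

HB.instance Definition _ := Measure_isSigmaFinite.Build _ _ _ lebesgue_tcons
  tcons_sigma_finite.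

End lebesgue_tcons.


Fixpoint lebesgue_tuple n : {sigma_finite_measure set (RT n) -> \bar R} :=
  if n is m.+1 then lebesgue_tcons (lebesgue_tuple m)
  else @dirac _ (RT 0) [tuple] R.

Lemma lebesgue_tuple_box n (A : 'I_n -> set (measurableTypeR R)) :
  (forall i, measurable (A i)) ->
  lebesgue_tuple n [set t | forall i, A i (tnth t i)] =
  (\prod_(i < n) lebesgue_measure (A i))%E.
Proof.
elim: n A => [A _|n IHn A mA].
  by rewrite big_ord0 /= diracE mem_set// => -[].
rewrite big_ord_recl -IHn//= /lebesgue_tcons /pushforward.
have mB : measurable [set t : RT n | forall i, A (lift ord0 i) (tnth t i)].
  rewrite (_ : mkset _ = \bigcap_(i : 'I_n)
      (@tnth n _ ^~ i @^-1` A (lift ord0 i))).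
    apply: fin_bigcap_measurable => // i _.
    by rewrite -[X in measurable X]setTI; exact: measurable_tnth.
  by apply/seteqP; split=> t /= tA i => [_|]; exact: (tA i).
rewrite -product_measure1E//.
congr ((_ \x _)%E _); apply/seteqP; split=> -[x t] /=.
  move=> xtA; split; first exact: (xtA ord0).
  by move=> i; have := xtA (lift ord0 i); rewrite tnthS.
move=> [xA tA] i; have [j ->|->] := unliftP ord0 i; last by rewrite tnth0.
by rewrite tnthS.
Qed.

End lebesgue_tuple.

Definition borelType (X : ptopologicalType) := g_sigma_algebraType (@open X).
Arguments borelType : clear implicits.
HB.instance Definition _ (X : ptopologicalType) := Measurable.on (borelType X).

Section lebesgue_rV.
Context {R : realType}.
Variable d : nat.

Definition row_of_tuple (t : d.-tuple (measurableTypeR R)) : borelType 'rV[R]_d :=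
  \row_i tnth t i.

Lemma open_rV_rat (U : set 'rV[R]_d) : open U ->
  U = \bigcup_(p in [set p : 'rV[rat]_d * nat |
        ball (map_mx ratr p.1 : 'rV[R]_d) p.2.+1%:R^-1 `<=` U])
      ball (map_mx ratr p.1 : 'rV[R]_d) p.2.+1%:R^-1.
Proof.
move=> oU; apply/seteqP; split=> [v Uv|v [p /= pU]]; last exact: pU.
have [e/= e0 veU] : exists2 e : R, 0 < e & ball v e `<=` U.
  by move: oU; rewrite openE => /(_ _ Uv) /nbhs_ballP[e/= e0 ?]; exists e.
have [k ke] : exists k : nat, k.+1%:R^-1 < e / 2.
  have e20 : 0 < e / 2 by rewrite divr_gt0.
  have [k _ /(_ k (leqnn _)) hk] := near_infty_natSinv_lt (PosNum e20).
  by exists k.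
have k0 : 0 < k.+1%:R^-1 :> R by rewrite invr_gt0.
have qP (i : 'I_d) : exists q : rat, `|ratr q - v 0 i| < k.+1%:R^-1.
  have /rat_in_itvoo[q] : v 0 i - k.+1%:R^-1 < v 0 i + k.+1%:R^-1.
    by rewrite ltrD2l gtrN.
  by rewrite in_itv/= => qv; exists q; rewrite ltr_distl.
have [q qv] := choice qP.
exists (\row_i q i, k) => /=; last first.
  by split=> // i j; rewrite !mxE ord1; exact: qv.
move=> w [_ qw]; apply: veU; split=> // i j.
have := qw i j; rewrite !mxE ord1 /ball/= => qwj.
rewrite -(subrK (ratr (q j)) (v 0 j)) -addrA (le_lt_trans (ler_normD _ _))//.
by rewrite (splitr e) ltrD// (lt_trans _ ke)// distrC.
Qed.

Lemma measurable_row_of_tuple : measurable_fun setT row_of_tuple.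
Proof.
apply: (@measurability _ _ _ (borelType _) setT row_of_tuple (@open _)) => //.
move=> _ [U oU <-].
rewrite setTI (open_rV_rat oU) preimage_bigcup.
rewrite bigcup_mkcond; apply: countable_bigcupT_measurable => // -[q k].
case: ifPn => _ //.
rewrite (_ : _ @^-1` _ = \bigcap_(i : 'I_d)
    (@tnth d _ ^~ i @^-1` ball (ratr (q 0 i) : R) k.+1%:R^-1)); last first.
  apply/seteqP; split=> t /=.
    by move=> [_ qt] i _; have := qt 0 i; rewrite !mxE.
  move=> qt; split=> [|i j]; first by rewrite invr_gt0.
  by have := qt j Logic.I; rewrite !mxE ord1.
apply: fin_bigcap_measurable => // i _.
rewrite -[X in measurable X]setTI; apply: measurable_tnth => //.
exact: measurable_ball.
Qed.

Definition lebesgue_rV : set (borelType 'rV[R]_d) -> \bar R :=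
  pushforward (lebesgue_tuple d) row_of_tuple.

Let lebesgue_rV0 : lebesgue_rV set0 = 0%E.
Proof. by rewrite /lebesgue_rV /pushforward preimage_set0 measure0. Qed.

Let lebesgue_rV_ge0 A : (0 <= lebesgue_rV A)%E.
Proof. by rewrite /lebesgue_rV /pushforward; exact: measure_ge0. Qed.

Let lebesgue_rV_sigma_additive : semi_sigma_additive lebesgue_rV.
Proof.
move=> F mF tF mUF; rewrite /lebesgue_rV /pushforward preimage_bigcup.
have mpre A : measurable A -> measurable (row_of_tuple @^-1` A).
  by move=> mA; rewrite -[X in measurable X]setTI; exact: measurable_row_of_tuple.
apply: measure_semi_sigma_additive.
- by move=> k; exact: mpre.
- apply/trivIsetP => i j _ _ ij; rewrite -preimage_setI.
  by move/trivIsetP : tF => /(_ _ _ Logic.I Logic.I ij) ->; rewrite preimage_set0.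
- by rewrite -preimage_bigcup; exact: mpre.
Qed.

HB.instance Definition _ := isMeasure.Build _ _ _ lebesgue_rV
  lebesgue_rV0 lebesgue_rV_ge0 lebesgue_rV_sigma_additive.

Lemma compact_measurable_rV (K : set 'rV[R]_d) : compact K ->
  measurable (K : set (borelType 'rV[R]_d)).
Proof.
move=> cK; rewrite -[K]setCK; apply: measurableC; apply: sub_sigma_algebra.
by apply: closed_openC; apply: compact_closed => //; exact: norm_hausdorff.
Qed.

Lemma lebesgue_rV_box (A : 'I_d -> set (measurableTypeR R)) :
  (forall i, measurable (A i)) ->
  lebesgue_rV [set v | forall i, A i (v 0 i)] =
  (\prod_(i < d) lebesgue_measure (A i))%E.
Proof.
move=> mA; rewrite -lebesgue_tuple_box// /lebesgue_rV /pushforward.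
by congr (lebesgue_tuple d _); apply/seteqP; split=> t /= tA i;
  have := tA i; rewrite mxE.
Qed.

End lebesgue_rV.
Arguments lebesgue_rV {R} d.

Section rca.
Variables (R : realType) (X : topologicalType).
Implicit Types (nu : set X -> R^o) (A B C U : set X).

(* X need not be pointed (here it is a compact set that may be empty), so the
   Borel sets of X are not packaged as a measurableType. *)
Definition borel : set (set X) := <<s @open X >>.

(* Regularity is as in Dunford-Schwartz: |nu|(U \ C) is small. The value 0 off
   the Borel sets makes elements with the same Borel values equal. *)
Definition is_rca nu : Prop :=
  [/\ forall A, ~ borel A -> nu A = 0,
      forall F : nat -> set X, (forall n, borel (F n)) -> trivIset setT F ->
        \sum_(i < n) nu (F i) @[n --> \oo] --> nu (\bigcup_n F n)
    & forall A (e : R), borel A -> 0 < e ->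
        exists C U, [/\ closed C, open U, C `<=` A, A `<=` U &
          forall B, borel B -> B `<=` U `\` C -> `|nu B| < e]].

Definition rca_pred : {pred set X -> R^o} := [pred nu | `[< is_rca nu >]].

Record rca : Type := Rca { rca_fun :> set X -> R^o ; _ : rca_fun \in rca_pred }.

HB.instance Definition _ := [isSub for rca_fun].
HB.instance Definition _ := [Choice of rca by <:].

Lemma is_rca_submod_closed : submod_closed rca_pred.
Proof.
split.
  apply/asboolP; split=> // [F mF tF|A e _ e0].
    under eq_fun do rewrite big1//.
    exact: cvg_cst.
  exists set0, setT; split=> //; [exact: closed0|exact: openT|].
  by move=> B _ _; rewrite normr0.
move=> a f g /asboolP[f0 fs fr] /asboolP[g0 gs gr]; apply/asboolP; split.
- move=> A nA; rewrite -[LHS]/(a * f A + g A).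
  by rewrite f0// g0// mulr0 addr0.
- move=> F mF tF.
  rewrite (_ : (fun n => _) = fun n : nat =>
      a * (\sum_(i < n) f (F i)) + \sum_(i < n) g (F i)).
    by apply: cvgD; [apply: cvgMl_tmp; exact: fs|exact: gs].
  by apply/funext => n; rewrite mulr_sumr -big_split.
- move=> A e mA e0.
  have a1 : 0 < `|a| + 1 by rewrite ltr_wpDl.
  have [|C [U [cC oU CA AU fUC]]] := fr A (e / 2 / (`|a| + 1)) mA.
    by rewrite !divr_gt0.
  have [|C' [U' [cC' oU' CA' AU' gUC]]] := gr A (e / 2) mA.
    by rewrite divr_gt0.
  exists (C `|` C'), (U `&` U'); split.
  + exact: closedU.
  + exact: openI.
  + by move=> x [/CA|/CA'].
  + by move=> x Ax; split; [exact: AU|exact: AU'].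
  + move=> B mB BUC; rewrite (splitr e) (le_lt_trans (ler_normD _ _))//.
    rewrite ltrD//.
      have {}fB : `|f B| < e / 2 / (`|a| + 1).
        by apply: fUC => // x /BUC[[Ux _] nC]; split=> // Cx; apply: nC; left.
      rewrite -[X in `|X|]/(a * f B) normrM.
      rewrite (le_lt_trans (y := (`|a| + 1) * `|f B|))//.
        by rewrite ler_wpM2r// lerDl.
      by rewrite mulrC -ltr_pdivlMr.
    by apply: gUC => // x /BUC[[_ Ux] nC]; split=> // Cx; apply: nC; right.
Qed.

HB.instance Definition _ :=
  GRing.isSubmodClosed.Build R _ rca_pred is_rca_submod_closed.
HB.instance Definition _ := [SubChoice_isSubLmodule of rca by <:].

Lemma rcaP (nu : rca) : is_rca nu.
Proof. by case: nu => f /= /asboolP. Qed.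

Lemma rca_eq (nu nu' : rca) : (forall A, borel A -> nu A = nu' A) -> nu = nu'.
Proof.
move=> nunu'; apply/val_inj/funext => A.
have [mA|nA] := pselect (borel A); first exact: nunu'.
by have [f0 _ _] := rcaP nu; have [g0 _ _] := rcaP nu'; rewrite /= f0// g0.
Qed.

Definition variation_sums nu : set R :=
  [set s | exists n, exists F : nat -> set X,
    [/\ forall i, borel (F i), trivIset setT F &
        s = \sum_(i < n) `|nu (F i)|]].

(* total variation norm *)
Definition rca_variation nu : R := sup (variation_sums nu).

Lemma rca_set0 (nu : rca) : nu set0 = 0.
Proof.
have [_ + _] := rcaP nu => /(_ (fun=> set0)).
rewrite bigcup0// => nu0.
have {}nu0 : \sum_(i < n) nu set0 @[n --> \oo] --> nu set0.
  by apply: nu0 => [n|]; [exact: sigma_algebra0|exact: trivIset_set0].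
have nu1 : \sum_(i < n.+1) nu set0 @[n --> \oo] --> nu set0.
  by rewrite -(cvg_shiftS (fun n => \sum_(i < n) nu set0)) in nu0.
have : (\sum_(i < n.+1) nu set0 - \sum_(i < n) nu set0) @[n --> \oo] -->
    nu set0 - nu set0 by exact: cvgB.
under eq_fun do rewrite big_ord_recr/= addrAC subrr add0r.
by rewrite subrr => /(cvg_unique _ (cvg_cst _)); apply.
Qed.

End rca.

Section charge_bound.
Variables (R : realType) (T : pointedType) (G : set (set T)) (nu : set T -> R).
Hypothesis nu0 : nu set0 = 0.
Hypothesis nusigma : forall F : nat -> set T, (forall n, <<s G >> (F n)) ->
  trivIset setT F ->
  \sum_(i < n) nu (F i) @[n --> \oo] --> nu (\bigcup_n F n).

Let enu (A : set (g_sigma_algebraType G)) : \bar R := (nu A)%:E.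

Let enu0 : enu set0 = 0%E. Proof. by rewrite /enu nu0. Qed.

Let enu_fin A : measurable A -> enu A \is a fin_num. Proof. by []. Qed.

Let enu_sigma : semi_sigma_additive enu.
Proof.
move=> F mF tF mUF; under eq_fun do rewrite sumEFin big_mkord.
apply: (cvg_comp _ _ (nusigma mF tF)).
by [].
Qed.

HB.instance Definition _ := isCharge.Build _ _ _ enu enu0 enu_fin enu_sigma.

Lemma sigma_additive_variation_bounded : exists M : R,
  forall n (F : nat -> set T), (forall i, <<s G >> (F i)) ->
    trivIset setT F -> \sum_(i < n) `|nu (F i)| <= M.
Proof.
have [P [N PN]] := Hahn_decomposition enu.
exists (fine (charge_variation PN setT)) => n F mF tF.
rewrite -lee_fin fineK ?fin_num_measure// -sumEFin.
apply: (@le_trans _ _ (\sum_(i < n) charge_variation PN (F i))%E).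
  apply: lee_sum => i _; exact: (@abse_charge_variation _ _ R enu _ _ PN _ (mF i)).
have mU : measurable (\big[setU/set0]_(i < n) F i : set (g_sigma_algebraType G)).
  by apply: bigsetU_measurable => i _; exact: mF.
have mF' k : (k < n)%N -> measurable (F k : set (g_sigma_algebraType G)).
  by move=> _; exact: mF.
have tF' : trivIset `I_n F by exact: sub_trivIset tF.
rewrite -(@measure_semi_additive_ord_I _ _ _ (charge_variation PN) F n mF' tF' mU).
by apply: le_measure => //; rewrite inE.
Qed.

End charge_bound.

Section rca_norm.
Variables (R : realType) (X : topologicalType).
Implicit Types nu : rca R X.

Lemma rca_variation_bounded nu : exists M : R, forall n (F : nat -> set X),
  (forall i, borel (F i)) -> trivIset setT F -> \sum_(i < n) `|nu (F i)| <= M.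
Proof.
have [[x0]|X0] := pselect (inhabited X).
  pose T : pointedType := HB.pack (Choice.sort X) (isPointed.Build X x0).
  have [_ nus _] := rcaP nu.
  exact: (@sigma_additive_variation_bounded R T (@open X) nu (rca_set0 nu) nus).
exists 0 => n F _ _; rewrite big1// => i _.
rewrite (_ : F i = set0) ?rca_set0 ?normr0//.
by apply/seteqP; split=> x // _; apply: X0; exists.
Qed.

Lemma variation_has_sup nu : has_sup (variation_sums nu).
Proof.
split.
  exists 0, 0%N, (fun=> set0); split; last by rewrite big_ord0.
    by move=> _; exact: sigma_algebra0.
  exact: trivIset_set0.
have [M nuM] := rca_variation_bounded nu.
by exists M => _ [n [F [mF tF ->]]]; exact: nuM.
Qed.

Lemma rca_variation_ub nu n (F : nat -> set X) : (forall i, borel (F i)) ->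
  trivIset setT F -> \sum_(i < n) `|nu (F i)| <= rca_variation nu.
Proof.
move=> mF tF; apply: sup_upper_bound; first exact: variation_has_sup.
by exists n, F.
Qed.

Lemma rca_variation_le nu (M : R) :
  (forall n (F : nat -> set X), (forall i, borel (F i)) -> trivIset setT F ->
    \sum_(i < n) `|nu (F i)| <= M) -> rca_variation nu <= M.
Proof.
move=> nuM; apply: ge_sup; first by have [] := variation_has_sup nu.
by move=> _ [n [F [mF tF ->]]]; exact: nuM.
Qed.

Lemma rca_variationD nu nu' :
  rca_variation (nu + nu') <= rca_variation nu + rca_variation nu'.
Proof.
apply: rca_variation_le => n F mF tF.
apply: le_trans (lerD (rca_variation_ub nu n mF tF)
  (rca_variation_ub nu' n mF tF)).
by rewrite -big_split; apply: ler_sum => i _; exact: ler_normD.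
Qed.

Let rca_variationZ_le (a : R) nu :
  rca_variation (a *: nu) <= `|a| * rca_variation nu.
Proof.
apply: rca_variation_le => n F mF tF.
apply: le_trans (ler_wpM2l (normr_ge0 a) (rca_variation_ub nu n mF tF)).
rewrite mulr_sumr; apply: ler_sum => i _.
by rewrite -[X in `|X|]/(a * nu (F i)) normrM.
Qed.

Lemma rca_variationZ (a : R) nu :
  rca_variation (a *: nu) = `|a| * rca_variation nu.
Proof.
apply/eqP; rewrite eq_le rca_variationZ_le/=.
have [->|a0] := eqVneq a 0.
  have := @rca_variation_ub (0 *: nu) 0 (fun=> set0).
  rewrite big_ord0 normr0 mul0r; apply; last exact: trivIset_set0.
  by move=> _; exact: sigma_algebra0.
rewrite -ler_pdivlMl ?normr_gt0// -normfV.
by rewrite -[in leLHS](scalerK a0 nu); exact: rca_variationZ_le.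
Qed.

Lemma rca_variation_eq0 nu : rca_variation nu = 0 -> nu = 0.
Proof.
move=> nu0; apply: rca_eq => A mA.
pose F i := if i is 0%N then A else set0.
have : \sum_(i < 1) `|nu (F i)| <= rca_variation nu.
  apply: rca_variation_ub; first by move=> [|i] //=; exact: sigma_algebra0.
  by move=> [|i] [|j] _ _ //= [x []].
by rewrite nu0 big_ord_recl big_ord0 addr0 normr_le0 => /eqP.
Qed.

HB.instance Definition _ := Lmodule_isNormed.Build R (rca R X)
  rca_variationD rca_variationZ rca_variation_eq0.

End rca_norm.

(* Convergence against all the bounded linear functionals of the seminormed
   space (E, N). A bounded functional vanishes where N does, so for a proper
   seminorm this is weak convergence in the quotient normed space. *)
Definition weakly_cvg (R : realType) (E : lmodType R) (N : E -> R)
    (x_ : nat -> E) (x : E) : Prop :=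
  forall phi : {linear E -> R^o}, (exists C : R, forall y, `|phi y| <= C * N y) ->
    phi (x_ n) @[n --> \oo] --> phi x.

Section young.
Variables (R : realType) (d : nat).
Local Notation V := 'rV[R]_d.
Implicit Types (Omega K : set V) (f : V -> V).

(* A countable partition Omega_0, Omega_1, ... with functions f_i and f_i^-1;
   finite partitions are padded with empty sets. Only the values of f_i on
   Omega_i and of f_i^-1 on f_i(Omega_i) matter. *)
Record pieces := Pieces {
  part : nat -> set V ;
  piece : nat -> V -> V ;
  piece_inv : nat -> V -> V }.

Implicit Types P : pieces.

Definition piece_img P i : set V := piece P i @` part P i.

(* The sets part P i exhaust Omega up to a Lebesgue-null set, on which the
   formula f = \sum_i f_i \chi_(Omega_i) is not imposed: the values of f there
   do not affect its Young measure, provided that f is a Borel function.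
   That f_i^-1 is continuously differentiable on f_i(Omega_i) includes that this
   set is open. *)
Definition m_oscillating Omega K P f : Prop :=
  [/\ [/\ forall i, open (part P i) /\ part P i `<=` Omega,
          trivIset setT (part P),
          \bigcup_i closure (part P i) = closure Omega &
          lebesgue_rV d (Omega `\` \bigcup_i part P i) = 0%E],
      forall i, [/\ forall x, part P i x -> K (piece P i x),
          forall x, part P i x -> piece_inv P i (piece P i x) = x,
          open (piece_img P i),
          forall y, piece_img P i y ->
            differentiable (piece_inv P i) y /\
            {for y, continuous (jacobian (piece_inv P i))} &
          compact (closure (piece_img P i))],
      forall i x, part P i x -> f x = piece P i x,
      @measurable_fun _ _ (borelType V) (borelType V) Omega f &
      compact (closure (f @` Omega))].

(* f_i^-1 is only defined on f_i(Omega_i): its Jacobian determinant is taken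
   to be 0 on the rest of the closure K_i. *)
Definition jac_inv P i (y : V) : R :=
  if y \in piece_img P i then \det (jacobian (piece_inv P i) y) else 0.

Definition total_slope P (y : V) : \bar R :=
  (\sum_(i <oo | y \in closure (piece_img P i)) `|jac_inv P i y|%:E)%E.

Definition monotonic_on K (g : nat -> V -> \bar R) : Prop :=
  (forall m n y, (m <= n)%N -> K y -> (g m y <= g n y)%E) \/
  (forall m n y, (m <= n)%N -> K y -> (g n y <= g m y)%E).

(* The image of dx / M, a measure on the subspace K, under f : Omega -> K *)
Definition is_young_measure Omega K (M : R) f (rho : rca R (set_type K)) : Prop :=
  forall A : set (set_type K), borel A ->
    (rho A)%:E =
    ((M^-1)%:E * lebesgue_rV d (Omega `&` f @^-1` (set_val @` A)))%E.

Definition homogeneous_young K (rho : rca R (set_type K)) : Prop :=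
  (forall A, 0 <= rho A) /\ rho setT = 1.

Definition lebesgue_on K (cK : compact K) :
    {measure set (borelType V) -> \bar R} :=
  mrestr (lebesgue_rV d) (compact_measurable_rV cK).

(* L^1(K) as a seminormed space: functions are not identified when they agree
   almost everywhere on K, and their values off K are irrelevant. *)
Definition L1 K (cK : compact K) := LfunType (lebesgue_on cK) (@lexx _ _ 1%E).

Definition L1norm K (cK : compact K) (u : L1 cK) : R :=
  fine 'N[lebesgue_on cK]_1[EFin \o u]%E.

Definition has_density K (cK : compact K) (rho : rca R (set_type K))
    (u : L1 cK) : Prop :=
  forall A : set (set_type K), borel A ->
    (rho A)%:E = (\int[lebesgue_on cK]_(x in set_val @` A) (u x)%:E)%E.

End young.

(* Main.v *)
Require Import Defs.
From HB Require Import structures.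
From mathcomp Require Import all_boot all_order all_algebra.
From mathcomp Require Import all_classical all_reals all_analysis.
From mathcomp Require Import perm measurable_realfun lra.
Import Order.TTheory GRing.Theory Num.Theory.
Import numFieldNormedType.Exports.
Set Implicit Arguments.
Unset Strict Implicit.
Unset Printing Implicit Defensive.
Local Open Scope classical_set_scope.
Local Open Scope ring_scope.

(** The sequence of Young measures is constant, which is why it converges.
    Write lambda for Lebesgue measure and nu_n for the image of lambda
    restricted to Omega under f_n, so that the Young measure of f_n is nu_n / M.
    The change of variables formula says that nu_n has density Jt_(f_n)
    [oscillating_density]. When the slopes are monotonic in n, any two of the
    nu_n are therefore comparable on the Borel subsets of K; but each of them
    gives K the mass M, and a finite measure lying below another one of the same
    total mass equals it [eq_measure_of_le]. Both weak convergences are then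
    convergences of constant sequences, and the common density is Jt_(f_0) / M,
    which is finite almost everywhere because its integral is 1.

    The substance of the proof is the change of variables for one piece: if
    g : O -> S is a continuously differentiable bijection from an open set, with
    a Borel inverse f, then lambda (S `&` f @^-1` A) is the integral of |det Dg|
    over A, for A inside O. The Jacobian determinant may vanish, so that f need
    not be differentiable. The formula is reached by comparing measures.

    - The norm of row vectors is the sup norm, whose balls are cubes. If phi
      expands distances by at least 1/c, then the preimage under phi of a cube
      of side s has diameter at most c s, hence lies in a cube of side c s: its
      measure is at most c^d times that of the cube. Comparing two measures on
      dyadic cubes is enough to compare them on Borel sets
      [le_measure_dyadic], so lambda (phi^-1 A) <= c^d lambda A for every Borel
      set A [lebesgue_rV_expanding].
    - For linear maps this bound is sharpened to |det N|^-1 by an LU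
      decomposition [mulmx_shrinks_det].
    - Near a point y, the map g differs from an affine map by a map with a small
      Lipschitz constant [C1_strictly_differentiable]. Seen through a linear
      frame, f expands by almost 1, which bounds the image measure from above
      [image_measure_local_le]; seen through Dg(y), so does g, which bounds it
      from below [image_measure_local_ge].
    - Since det Dg is continuous, these infinitesimal bounds identify the
      density [density_of_local_bounds]. *)

(** * Regularity of finite Borel measures *)

Lemma cvge_exists_lt (R : realType) (u : nat -> \bar R) (l e : \bar R) :
  u n @[n --> \oo] --> l -> (l < e)%E -> exists n, (u n < e)%E.
Proof.
move=> /[swap] le /(_ [set t | t < e]%E)[|N _ /(_ N (leqnn N))]; last by exists N.
by apply: open_nbhs_nbhs; split=> //; exact: open_ereal_lt_ereal.
Qed.

Section regularity.
Context {R : realType} {X : normedModType R}.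
Variable m : {measure set (borelType X) -> \bar R}.
Hypothesis m_fin : (m setT < +oo)%E.

(** One gap U minus C, instead of separate inner and outer approximations, makes
    the notion visibly stable under complement. *)
Definition regular_set (A : set X) : Prop := forall e : R, 0 < e ->
  exists C U, [/\ closed C, open U, C `<=` A, A `<=` U &
    (m (U `\` C : set (borelType X)) < e%:E)%E].

Lemma borel_open_measurable (U : set X) : open U -> measurable (U : set (borelType X)).
Proof. by move=> oU; exact: sub_sigma_algebra. Qed.

Lemma borel_closed_measurable (C : set X) :
  closed C -> measurable (C : set (borelType X)).
Proof.
move=> cC; rewrite -[C]setCK; apply: measurableC.
by apply: borel_open_measurable; exact: closed_openC.
Qed.

Let fin (A : set (borelType X)) : measurable A -> (m A < +oo)%E.
Proof.
by move=> mA; apply: le_lt_trans m_fin; apply: le_measure; rewrite ?inE.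
Qed.

(** A closed set is the intersection of its open 1/(n+1)-neighbourhoods, whose
    measures decrease to its own since the measure is finite. *)
Lemma regular_closed (F : set X) : closed F -> regular_set F.
Proof.
move=> cF e e0.
pose U n := \bigcup_(x in F) (ball x n.+1%:R^-1)°.
have oU n : open (U n) by apply: bigcup_open => x _; exact: open_interior.
have FU n : F `<=` U n.
  move=> x Fx; exists x => //; rewrite /interior /=.
  by apply: nbhsx_ballx; rewrite invr_gt0.
have mFU n : measurable (U n `\` F : set (borelType X)).
  by apply: measurableD; [exact: borel_open_measurable|exact: borel_closed_measurable].
have cap0 : \bigcap_n (U n `\` F) = set0 :> set (borelType X).
  rewrite -subset0 => y UFy; have [_ nFy] := UFy 0%N Logic.I.
  apply: nFy; move/closure_id : cF => -> B /nbhs_ballP[r/= r0 rB].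
  have [k _ /(_ k (leqnn _)) kr] := near_infty_natSinv_lt (PosNum r0).
  have [[x Fx /interior_subset xy] _] := UFy k Logic.I.
  exists x; split=> //; apply: rB; apply: ball_sym.
  by apply: le_ball xy; exact: ltW.
have : (m \o (fun n => U n `\` F : set (borelType X))) n @[n --> \oo]
    --> m (\bigcap_n (U n `\` F)).
  apply: nonincreasing_cvg_mu => //.
  - exact: fin.
  - by rewrite cap0.
  - move=> i j ij; apply/subsetPset; apply: setSD => x [z Fz zx].
    exists z => //; apply: interiorS zx; apply: le_ball.
    by rewrite lef_pV2 ?posrE// ler_nat ltnS.
rewrite cap0 measure0 => /cvge_exists_lt => /(_ e%:E); rewrite lte_fin => -[//|N mN].
by exists F, (U N); split=> //; exact: FU.
Qed.

Lemma regular_setC (A : set X) : regular_set A -> regular_set (~` A).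
Proof.
move=> rA e /rA[C [U [cC oU CA AU mUC]]].
exists (~` U), (~` C); split.
- exact: open_closedC.
- exact: closed_openC.
- exact: subsetC.
- exact: subsetC.
- by rewrite setDE setCK setIC -setDE.
Qed.

(** Errors e / 2^(n+2) are spread over the sets; the union of the inner closed
    sets need not be closed, so it is cut off at a finite stage, which costs
    little by continuity from above. *)
Lemma regular_bigcup (A : nat -> set X) : (forall n, regular_set (A n)) ->
  regular_set (\bigcup_n A n).
Proof.
move=> rA e e0.
have e20 : 0 < e / 2 by rewrite divr_gt0.
have rA' n : exists CU : set X * set X, [/\ closed CU.1, open CU.2,
   CU.1 `<=` A n, A n `<=` CU.2 &
    (m (CU.2 `\` CU.1 : set (borelType X)) < (e / 2 / (2 ^ n.+1)%:R)%:E)%E].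
  have [|C [U ?]] := rA n (e / 2 / (2 ^ n.+1)%:R).
    by rewrite divr_gt0// ltr0n expn_gt0.
  by exists (C, U).
have [CU hCU] := choice rA'.
pose U := \bigcup_n (CU n).2.
pose C n := \big[setU/set0]_(i < n) (CU i).1.
have CE n : C n = \bigcup_(i in [set k | (k < n)%N]) (CU i).1.
  by rewrite /C (bigcup_mkord n (fun i => (CU i).1)).
have oU : open U by apply: bigcup_open => n _; have [] := hCU n.
have cC n : closed (C n).
  by apply: closed_bigsetU => i _; have [] := hCU i.
have mUC n : measurable (U `\` C n : set (borelType X)).
  by apply: measurableD; [exact: borel_open_measurable|exact: borel_closed_measurable].
have capE : \bigcap_n (U `\` C n) = U `\` \bigcup_n (CU n).1 :> set X.
  apply/seteqP; split=> x.
    move=> xUC; split; first by have [] := xUC 0%N Logic.I.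
    move=> [n _ Cnx]; have [_] := xUC n.+1 Logic.I; apply.
    by rewrite CE; exists n => /=.
  move=> [Ux nCx] n _; split=> // Cnx; apply: nCx.
  by move: Cnx; rewrite CE => -[i _ ?]; exists i.
have mCU n : measurable ((CU n).2 `\` (CU n).1 : set (borelType X)).
  have [cCU oCU _ _ _] := hCU n; apply: measurableD.
    exact: borel_open_measurable.
  exact: borel_closed_measurable.
have mcap : measurable (\bigcap_n (U `\` C n) : set (borelType X)).
  exact: bigcap_measurable.
have small : (m (\bigcap_n (U `\` C n)) < e%:E)%E.
  apply: (@le_lt_trans _ _ (e / 2)%:E); last by rewrite lte_fin; lra.
  apply: (@le_trans _ _ (m (\bigcup_n ((CU n).2 `\` (CU n).1)))).
    apply: le_measure; rewrite ?inE//.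
      exact: bigcup_measurable.
    rewrite capE => x [[n _ Unx] nC]; exists n => //; split=> // Cnx.
    by apply: nC; exists n.
  apply: le_trans (le_mu_bigcup _ _ _) _; [by []|exact: bigcup_measurable|].
  apply: (@le_trans _ _ (\sum_(0 <= i <oo) (0 + (e / 2 / (2 ^ i.+1)%:R)%:E))%E).
    apply: lee_nneseries => // n _.
    by rewrite add0e; have [_ _ _ _ /ltW] := hCU n.
  apply: le_trans (epsilon_trick _ _ _) _ => //; first exact: ltW.
  by rewrite eseries0 ?add0e// lexx.
have : (m \o (fun n => U `\` C n : set (borelType X))) n @[n --> \oo]
    --> m (\bigcap_n (U `\` C n)).
  apply: nonincreasing_cvg_mu => //; first exact: fin.
  move=> i j ij; apply/subsetPset; apply: setDS.
  rewrite !CE => x [k /= ki Ckx]; exists k => //=.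
  exact: leq_trans ki ij.
move=> /cvge_exists_lt => /(_ _ small)[N ?].
exists (C N), U; split=> //.
- rewrite CE => x [i _ Cix]; exists i => //.
  by have [_ _ + _ _] := hCU i; apply.
- move=> x [i _ Aix]; exists i => //.
  by have [_ _ _ + _] := hCU i; apply.
Qed.

Lemma finite_measure_regular (A : set (borelType X)) :
  measurable A -> regular_set A.
Proof.
move: A; rewrite -/(_ `<=` _); apply: smallest_sub.
  split.
  - by apply: regular_closed; exact: closed0.
  - by move=> A rA; rewrite setTD; exact: regular_setC.
  - by move=> A; exact: regular_bigcup.
move=> U oU; rewrite -[U]setCK; apply: regular_setC; apply: regular_closed.
exact: open_closedC.
Qed.

End regularity.

Section continuous_on_open.

Lemma open_setI_preimage (X Y : topologicalType) (U : set X) (f : X -> Y)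
    (W : set Y) : open U -> (forall x, U x -> {for x, continuous f}) ->
  open W -> open (U `&` f @^-1` W).
Proof.
move=> oU cf; rewrite openE => oW; rewrite openE => x [Ux Wfx].
apply: filterI; first by move: oU; rewrite openE; exact.
by apply: (cf x Ux); exact: oW.
Qed.

Lemma measurable_fun_continuous_open (X Y : ptopologicalType) (U : set X)
    (f : X -> Y) : open U -> (forall x, U x -> {for x, continuous f}) ->
  @measurable_fun _ _ (borelType X) (borelType Y) U f.
Proof.
move=> oU cf mU; apply: (@measurability _ _ _ (borelType Y) _ _ (@open Y)) => //.
move=> _ [W oW <-]; apply: sub_sigma_algebra; exact: open_setI_preimage.
Qed.

Lemma measurable_fun_continuous_open_real (R : realType) (X : ptopologicalType)
    (U : set X) (f : X -> R) : open U ->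
  (forall x, U x -> {for x, continuous f}) ->
  @measurable_fun _ _ (borelType X) (measurableTypeR R) U f.
Proof.
move=> oU cf mU; apply: (measurability _ (RGenOpens.measurableE R)) => //.
move=> _ [_ [a [b ->] <-]]; apply: sub_sigma_algebra.
by apply: open_setI_preimage => //; exact: itv_open.
Qed.

End continuous_on_open.

(** * Comparison of measures on dyadic cubes *)

Section row_norm.
Context {R : realType} {d : nat}.
Implicit Types v : 'rV[R]_d.

Lemma rV_norm_coord v j : `|v 0 j| <= `|v|.
Proof.
rewrite [leRHS]/Num.Def.normr /= mx_normrE; apply/bigmax_geP; right => /=.
by exists (0, j).
Qed.

Lemma rV_norm_le v (e : R) : 0 <= e -> (forall j, `|v 0 j| <= e) -> `|v| <= e.
Proof.
move=> e0 ve; rewrite [leLHS]/Num.Def.normr /= mx_normrE bigmax_le// => -[i j] _ /=.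
by rewrite ord1.
Qed.

End row_norm.

Section dyadic.
Context {R : realType} {d : nat}.
Local Notation V := 'rV[R]_d.
Local Notation B := (borelType V).
Local Notation lam := (lebesgue_rV d).

(** Half-open cubes of side 2^-k: each level is a partition of the space. *)
Definition dyadic_cube k (z : 'rV[int]_d) : set V :=
  [set v | forall i, Num.floor (2 ^+ k * v 0 i) = z 0 i].

Definition dyadic_index k (v : V) : 'rV[int]_d :=
  \row_i Num.floor (2 ^+ k * v 0 i).

Lemma dyadic_cubeP k z v : dyadic_cube k z v <-> dyadic_index k v = z.
Proof.
split=> [vz|<- i]; last by rewrite mxE.
by apply/rowP => i; rewrite mxE; exact: vz.
Qed.

Lemma measurable_coord (A : 'I_d -> set (measurableTypeR R)) :
  (forall i, measurable (A i)) ->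
  measurable ([set v : V | forall i, A i (v 0 i)] : set B).
Proof.
move=> mA; rewrite (_ : mkset _ = \bigcap_(i : 'I_d) ((fun v : V => v 0 i) @^-1` A i)).
  apply: fin_bigcap_measurable => // i _.
  have := mA i; rewrite -[X in _ -> measurable X]setTI => mAi.
  suff : @measurable_fun _ _ B (measurableTypeR R) setT (fun v : V => v 0 i).
    by apply.
  apply: measurable_fun_continuous_open_real; first exact: openT.
  by move=> v _; exact: coord_continuous.
by apply/seteqP; split=> v /= vA i => [_|]; exact: (vA i).
Qed.

Definition dyadic_side k (z : 'rV[int]_d) (i : 'I_d) : set (measurableTypeR R) :=
  `[(z 0 i)%:~R / 2 ^+ k, (z 0 i + 1)%:~R / 2 ^+ k[%classic.

Lemma dyadic_cubeE k z :
  dyadic_cube k z = [set v | forall i, dyadic_side k z i (v 0 i)].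
Proof.
have k0 : 0 < 2 ^+ k :> R by rewrite exprn_gt0.
apply/seteqP; split => v /= vz i; have := vz i; rewrite /dyadic_side.
  move=> <-; rewrite /= in_itv/= ler_pdivrMr// ltr_pdivlMr// mulrC.
  exact: floor_itv.
rewrite /= in_itv/= ler_pdivrMr// ltr_pdivlMr// mulrC => /andP[zv vz1].
by apply: floor_def; rewrite zv.
Qed.

Lemma measurable_dyadic_cube k z : measurable (dyadic_cube k z : set B).
Proof.
rewrite dyadic_cubeE.
by apply: (@measurable_coord (dyadic_side k z)) => i; exact: measurable_itv.
Qed.

Lemma lebesgue_dyadic_cube k z : lam (dyadic_cube k z) = ((2 ^- k) ^+ d)%:E.
Proof.
rewrite dyadic_cubeE (@lebesgue_rV_box _ _ (dyadic_side k z)); last first.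
  by move=> i; exact: measurable_itv.
rewrite (eq_bigr (fun=> (2 ^- k)%:E)); last first.
  move=> i _; rewrite /dyadic_side lebesgue_measure_itv/= lte_fin.
  rewrite ltr_pM2r ?invr_gt0 ?exprn_gt0//.
  by rewrite ltr_int ltrDl/= -EFinD -mulrBl intrD addrAC subrr add0r mul1r.
by rewrite prodEFin prodr_const card_ord.
Qed.

(** The dyadic partitions are nested, because the floor of t is determined by
    the floor of 2t. *)
Lemma dyadic_index_refine k (v w : V) :
  dyadic_index k.+1 v = dyadic_index k.+1 w -> dyadic_index k v = dyadic_index k w.
Proof.
move=> /rowP vw; apply/rowP => i; rewrite !mxE.
have {vw} : Num.floor (2 * (2 ^+ k * v 0 i)) = Num.floor (2 * (2 ^+ k * w 0 i)).
  by have := vw i; rewrite !mxE !exprS !mulrA.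
set s := 2 ^+ k * v 0 i; set t := 2 ^+ k * w 0 i.
have le (x y : R) : Num.floor (2 * x) = Num.floor (2 * y) ->
    (Num.floor x <= Num.floor y)%R.
  move=> xy; rewrite floor_ge_int.
  have : ((2 * Num.floor x)%:~R <= 2 * y :> R).
    rewrite -floor_ge_int -xy floor_ge_int intrM ler_pM2l//.
    by have /andP[] := floor_itv x.
  by rewrite intrM ler_pM2l.
by move=> st; apply/eqP; rewrite eq_le !le.
Qed.

Lemma dyadic_cube_dist k z (v w : V) i : dyadic_cube k z v -> dyadic_cube k z w ->
  `|v 0 i - w 0 i| < 2 ^- k.
Proof.
move=> vz wz.
have k0 : 0 < 2 ^+ k :> R by rewrite exprn_gt0.
have := floor_itv (2 ^+ k * v 0 i); have := floor_itv (2 ^+ k * w 0 i).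
rewrite (vz i) (wz i) !intrD => /andP[h1 h2] /andP[h3 h4].
rewrite -[2 ^- k]mul1r ltr_pdivlMr// -[X in _ * X](gtr0_norm k0) -normrM mulrBl.
rewrite ltr_distl; apply/andP; split.
  by rewrite ltrBlDr ![_ * 2 ^+ k]mulrC; apply: lt_le_trans h2 _; rewrite lerD2r.
by rewrite ![_ * 2 ^+ k]mulrC; apply: lt_le_trans h4 _; rewrite lerD2r.
Qed.

(** The union of the level-k cubes that lie inside U. For U open it increases to
    U as k grows. *)
Let dyadic_inside k (U : set V) : set V :=
  [set v | dyadic_cube k (dyadic_index k v) `<=` U].

(** The same union as a disjoint sequence; the cubes are indexed by a countable
    type, and the unused natural numbers get the empty set. *)
Let dyadic_enum k (U : set V) (n : nat) : set V :=
  if pickle_inv n is Some z then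
    if `[< dyadic_cube k z `<=` U >] then dyadic_cube k z else set0
  else set0.

Let dyadic_insideE k U : dyadic_inside k U = \bigcup_n dyadic_enum k U n.
Proof.
apply/seteqP; split=> v /=.
  move=> vU; exists (pickle (dyadic_index k v)) => //.
  by rewrite /dyadic_enum pickleK_inv asboolT//; apply/dyadic_cubeP.
move=> [n _]; rewrite /dyadic_enum; case: pickle_inv => // z.
case: asboolP => // zU; by rewrite /dyadic_inside /= => /dyadic_cubeP ->.
Qed.

Let measurable_dyadic_enum k U n : measurable (dyadic_enum k U n : set B).
Proof.
rewrite /dyadic_enum; case: pickle_inv => // z; case: asboolP => // _.
exact: measurable_dyadic_cube.
Qed.

Let trivIset_dyadic_enum k U : trivIset setT (dyadic_enum k U).
Proof.
apply/trivIsetP => i j _ _; apply: contra_neqP => /eqP/set0P[v []].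
rewrite /dyadic_enum.
have := @pickle_invK 'rV[int]_d i; have := @pickle_invK 'rV[int]_d j.
case: pickle_inv => // z /=; case: pickle_inv => // z' /= <- <-.
case: asboolP => // _ /dyadic_cubeP <-.
by case: asboolP => // _ /dyadic_cubeP <-.
Qed.

Let dyadic_inside_bigcup U : open U -> \bigcup_k dyadic_inside k U = U.
Proof.
move=> oU; apply/seteqP; split=> v.
  by move=> [k _]; apply; apply/dyadic_cubeP.
move=> Uv.
have [e/= e0 veU] : exists2 e : R, 0 < e & ball v e `<=` U.
  by move: oU; rewrite openE => /(_ _ Uv) /nbhs_ballP[e/= e0 ?]; exists e.
have [k ke] : exists k, 2 ^- k < e.
  have [k _ /(_ k (leqnn _)) hk] := near_infty_natSinv_lt (PosNum e0).
  exists k; apply: le_lt_trans hk.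
  rewrite lef_pV2 ?posrE ?exprn_gt0//.
  by rewrite -natrX ler_nat; exact: ltn_expl.
exists k => // w wv; apply: veU; split=> // i j; rewrite ord1.
rewrite /ball/=; apply: lt_trans ke.
by apply: dyadic_cube_dist wv; apply/dyadic_cubeP.
Qed.

Let dyadic_inside_homo U :
  {homo dyadic_inside ^~ U : m n / (m <= n)%N >-> (m <= n)%O}.
Proof.
apply: homo_leq => [x|y x z xy yz|k]; [exact: lexx|exact: le_trans yz|].
apply/subsetPset => v vU w wv; apply: vU; move/dyadic_cubeP : wv => wv.
by apply/dyadic_cubeP; exact: dyadic_index_refine.
Qed.

(** Bounded open sets of finite measure that exhaust the space: they reduce
    statements about Lebesgue measure to finite measures. *)
Definition centered_box n : set V :=
  [set v | forall i, `]- n%:R, n%:R[%classic (v 0 i)].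

Lemma measurable_centered_box n : measurable (centered_box n : set B).
Proof. by apply: (@measurable_coord (fun=> `]- n%:R, n%:R[%classic)). Qed.

Lemma lebesgue_centered_box n : (lam (centered_box n) < +oo)%E.
Proof.
rewrite (@lebesgue_rV_box _ _ (fun=> `]- n%:R, n%:R[%classic))//.
rewrite (eq_bigr (fun=> (if (- n%:R < n%:R :> R) then n%:R + n%:R else 0)%:E)).
  by rewrite prodEFin ltry.
move=> i _; rewrite lebesgue_measure_itv/= lte_fin; case: ifPn => _ //.
by rewrite -EFinB opprK.
Qed.

Lemma open_centered_box n : open (centered_box n).
Proof.
rewrite openE => v vn; apply: (@filter_forall _ _
  (fun i => [set w : V | `]- n%:R, n%:R[%classic (w 0 i)]) (nbhs v)) => i.
have : nbhs (v 0 i) `]- n%:R, n%:R[%classic.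
  by apply: open_nbhs_nbhs; split; [exact: itv_open|exact: vn].
exact: (@coord_continuous R 1 d 0 i v).
Qed.

Lemma bigcup_centered_box : \bigcup_n centered_box n = setT.
Proof.
apply/seteqP; split=> // v _.
exists (Num.truncn `|v|).+1 => // i; rewrite /= in_itv/= -ltr_norml.
apply: le_lt_trans (truncnS_gt _).
exact: rV_norm_coord.
Qed.

Lemma centered_box_homo : {homo centered_box : m n / (m <= n)%N >-> (m <= n)%O}.
Proof.
move=> m n mn; apply/subsetPset => v vm i; have := vm i; rewrite /= !in_itv/=.
have : m%:R <= n%:R :> R by rewrite ler_nat.
by move=> ? /andP[? ?]; apply/andP; split; lra.
Qed.

Lemma lebesgue_outer_regular n (A : set B) (e : R) : measurable A ->
  A `<=` centered_box n -> 0 < e ->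
  exists U : set V, [/\ open U, A `<=` U & (lam U <= lam A + e%:E)%E].
Proof.
move=> mA An e0.
have [|C [U [cC oU CA AU UC]]] :=
    @finite_measure_regular R V (mrestr lam (measurable_centered_box n)) _ A mA e e0.
  by rewrite /= /mrestr setTI; exact: lebesgue_centered_box.
have mU := borel_open_measurable oU; have mC := borel_closed_measurable cC.
have mn := measurable_centered_box n.
exists (U `&` centered_box n); split=> //.
- by apply: openI => //; exact: open_centered_box.
- by move=> x Ax; split; [exact: AU|exact: An].
have UE : (U `&` centered_box n) = A `|` ((U `&` centered_box n) `\` A).
  apply/seteqP; split=> x; first by case: (pselect (A x)); [left|right].
  by move=> [Ax|[]//]; split; [exact: AU|exact: An].
rewrite UE; apply: le_trans (measureU2 _ _ _) _ => //.
  by apply: measurableD => //; exact: measurableI.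
rewrite leeD2l//; apply: le_trans (ltW UC); rewrite /= /mrestr.
apply: le_measure; rewrite ?inE.
- by apply: measurableD => //; exact: measurableI.
- by apply: measurableI => //; exact: measurableD.
by move=> x [[Ux nx] nA]; split=> //; split=> // /CA.
Qed.

(** An inequality between measures that holds on small cubes passes to open sets,
    which are increasing limits of disjoint unions of cubes, then to bounded
    Borel sets by outer regularity of Lebesgue measure, and then to all Borel
    sets by exhaustion. *)
Lemma le_measure_dyadic (m : {measure set B -> \bar R}) (c : R) : 0 <= c ->
  (forall k z, (m (dyadic_cube k z) <= c%:E * lam (dyadic_cube k z))%E) ->
  forall A : set B, measurable A -> (m A <= c%:E * lam A)%E.
Proof.
move=> c0 mc.
have m_inside k (U : set V) :
    (m (dyadic_inside k U) <= c%:E * lam (dyadic_inside k U))%E.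
  rewrite dyadic_insideE.
  have mE := measurable_dyadic_enum k U; have tE := @trivIset_dyadic_enum k U.
  rewrite !measure_bigcup//= -nneseriesZl//.
  apply: lee_nneseries => // n _; rewrite /dyadic_enum; case: pickle_inv => [z|].
    by case: asboolP => // _; rewrite !measure0 mule0.
  by rewrite !measure0 mule0.
have minside k U : measurable (dyadic_inside k U : set B).
  by rewrite dyadic_insideE; exact: bigcup_measurable.
have m_open (U : set V) : open U -> (m U <= c%:E * lam U)%E.
  move=> oU; rewrite -{1}(dyadic_inside_bigcup oU).
  have mU := borel_open_measurable oU.
  have : (m \o (fun k => dyadic_inside k U : set B)) k @[k --> \oo]
      --> m (\bigcup_k dyadic_inside k U).
    apply: nondecreasing_cvg_mu => //; first by rewrite dyadic_inside_bigcup.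
  move=> /cvge_to_le; apply; apply: nearW => k /=; apply: le_trans (m_inside k U) _.
  apply: lee_wpmul2l; rewrite ?lee_fin//; apply: le_measure; rewrite ?inE//.
  by rewrite -{2}(dyadic_inside_bigcup oU); exact: (@bigcup_sup _ _ k).
have m_bounded n (A : set B) : measurable A -> A `<=` centered_box n ->
    (m A <= c%:E * lam A)%E.
  move=> mA An.
  apply/lee_addgt0Pr => e e0.
  have c1 : 0 < c + 1 by lra.
  have [|U [oU AU lU]] := @lebesgue_outer_regular n A (e / (c + 1)) mA An.
    by rewrite divr_gt0.
  apply: (@le_trans _ _ (m U)).
    by apply: le_measure; rewrite ?inE//; exact: borel_open_measurable.
  apply: le_trans (m_open _ oU) _.
  apply: (@le_trans _ _ (c%:E * (lam A + (e / (c + 1))%:E))%E).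
    by apply: lee_wpmul2l; rewrite ?lee_fin.
  rewrite ge0_muleDr ?lee_fin//; last by rewrite divr_ge0// ltW.
  rewrite leeD2l// -EFinM lee_fin mulrCA ger_pMr// ler_pdivrMr//; lra.
move=> A mA.
have AE : \bigcup_n (A `&` centered_box n) = A.
  by rewrite -setI_bigcupr bigcup_centered_box setIT.
have mAn n : measurable (A `&` centered_box n : set B).
  by apply: measurableI => //; exact: measurable_centered_box.
rewrite -{1}AE.
have : (m \o (fun n => A `&` centered_box n : set B)) n @[n --> \oo]
    --> m (\bigcup_n (A `&` centered_box n)).
  apply: nondecreasing_cvg_mu => //; first by rewrite AE.
  move=> i j ij; apply/subsetPset; apply: setIS.
  by apply/subsetPset; exact: centered_box_homo.
move=> /cvge_to_le; apply; apply: nearW => n /=.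
apply: le_trans (m_bounded n _ _ _) _ => //.
apply: lee_wpmul2l; rewrite ?lee_fin//; apply: le_measure; rewrite ?inE//.
Qed.

End dyadic.

(** * Lebesgue measure under expanding maps and linear maps *)

Section image_measure.
Context d1 d2 (T1 : measurableType d1) (T2 : measurableType d2) (R : realType).
Variables (mu : {measure set T1 -> \bar R}) (D : set T1) (phi : T1 -> T2).
Hypotheses (mD : measurable D) (mphi : measurable_fun D phi).

(** The image measure for a map that is only measurable on D: the two proofs are
    arguments so that the set function carries its measure structure. *)
Definition image_measure of measurable D & measurable_fun D phi :=
  fun A : set T2 => mu (D `&` phi @^-1` A).

Local Notation nu := (image_measure mD mphi).

Let nu0 : nu set0 = 0%E.
Proof. by rewrite /image_measure preimage_set0 setI0 measure0. Qed.

Let nu_ge0 A : (0 <= nu A)%E. Proof. exact: measure_ge0. Qed.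

Let nu_sigma : semi_sigma_additive nu.
Proof.
move=> F mF tF mUF; rewrite /image_measure preimage_bigcup setI_bigcupr.
apply: measure_semi_sigma_additive.
- by move=> k; exact: mphi.
- apply/trivIsetP => i j _ _ ij; rewrite setIACA setIid -preimage_setI.
  by move/trivIsetP : tF => /(_ _ _ Logic.I Logic.I ij) ->; rewrite preimage_set0 setI0.
- by rewrite -setI_bigcupr -preimage_bigcup; exact: mphi.
Qed.

HB.instance Definition _ := isMeasure.Build _ _ _ nu nu0 nu_ge0 nu_sigma.

End image_measure.

Lemma exprn_le_near1 (R : realType) d (e : R) : 1 < e ->
  exists2 c : R, 1 < c & c ^+ d <= e.
Proof.
move=> e1.
have main (x : R) : 0 < x -> x <= 1 -> (1 + x) ^+ d <= 1 + 3 ^+ d * x.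
  move=> x0 x1; elim: d => [|n IH]; first by rewrite !expr0; lra.
  have n1 : 1 <= 3 ^+ n :> R by rewrite exprn_ege1//; lra.
  rewrite exprS; apply: (@le_trans _ _ ((1 + x) * (1 + 3 ^+ n * x))).
    by apply: ler_wpM2l IH; lra.
  rewrite exprS; set y := 3 ^+ n; rewrite -/y in n1; clear IH.
  have h1 : x <= y * x by rewrite ler_peMl// ltW.
  have h2 : y * x * x <= y * x by rewrite ger_pMr// mulr_gt0//; lra.
  nra.
have p0 : 0 < 3 ^+ d :> R by rewrite exprn_gt0.
pose x : R := Num.min 1 ((e - 1) / 3 ^+ d).
have x0 : 0 < x by rewrite lt_min ltr01 divr_gt0// subr_gt0.
exists (1 + x); first by lra.
apply: le_trans (main _ x0 _) _; first by rewrite ge_min lexx.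
rewrite -lerBrDl mulrC -ler_pdivlMr//.
by rewrite ge_min lexx orbT.
Qed.

Lemma lee_mul_near1 (R : realType) (x y : \bar R) : (0 <= y)%E ->
  (forall e : R, 1 < e -> (x <= e%:E * y)%E) -> (x <= y)%E.
Proof.
case: y => [y| |]//; last by move=> _ _; rewrite leey.
rewrite lee_fin => y0 H; apply/lee_addgt0Pr => e e0.
have y1 : 0 < y + 1 by lra.
apply: le_trans (H (1 + e / (y + 1)) _) _; first by rewrite ltrDl divr_gt0.
rewrite -EFinM -EFinD lee_fin mulrDl mul1r lerD2l mulrAC -mulrA ger_pMr//.
by rewrite ler_pdivrMr//; lra.
Qed.

Section row_mulmx.
Context {R : realType} {d : nat}.
Implicit Types (v : 'rV[R]_d) (N : 'M[R]_d).

Lemma rV_norm_mulmx v N (C : R) : 0 <= C -> (forall i j, `|N i j| <= C) ->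
  `|v *m N| <= d%:R * C * `|v|.
Proof.
move=> C0 NC; apply: rV_norm_le => [|j]; first by rewrite !mulr_ge0.
rewrite mxE; apply: le_trans (ler_norm_sum _ _ _) _.
rewrite -[X in X%:R](card_ord d) -mulrA mulr_natl -sumr_const.
apply: ler_sum => i _; rewrite normrM mulrC.
by apply: ler_pM => //; exact: rV_norm_coord.
Qed.

Lemma rV_norm_mulmx_bounded N :
  exists2 C : R, 0 < C & forall v, `|v *m N| <= C * `|v|.
Proof.
pose C0 := \sum_i \sum_j `|N i j|.
have C00 : 0 <= C0 by apply: sumr_ge0 => i _; apply: sumr_ge0.
have NC i j : `|N i j| <= C0.
  rewrite /C0 (bigD1 i)//= (bigD1 j)//= -addrA lerDl addr_ge0//.
    by apply: sumr_ge0.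
  by apply: sumr_ge0 => k _; apply: sumr_ge0.
exists (d%:R * C0 + 1) => [|v]; first by rewrite ltr_wpDl// mulr_ge0.
apply: le_trans (rV_norm_mulmx v C00 NC) _.
by rewrite ler_wpM2r// lerDl.
Qed.

Lemma continuous_mulmxr N : continuous (fun v => v *m N).
Proof.
have [C C0 NC] := rV_norm_mulmx_bounded N.
move=> v W /nbhs_ballP[e /= e0 eW]; apply/nbhs_ballP.
exists (e / C) => /=; first by rewrite divr_gt0.
move=> w; rewrite -ball_normE /= => vw; apply: eW; rewrite -ball_normE /=.
rewrite -mulmxBl; apply: le_lt_trans (NC _) _.
by rewrite mulrC -ltr_pdivlMr.
Qed.

Lemma measurable_mulmxr N :
  @measurable_fun _ _ (borelType 'rV[R]_d) (borelType 'rV[R]_d) setT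
    (fun v => v *m N).
Proof.
apply: measurable_fun_continuous_open; first exact: openT.
by move=> v _; exact: continuous_mulmxr.
Qed.

End row_mulmx.

Section expanding.
Context {R : realType} {d : nat}.
Local Notation V := 'rV[R]_d.
Local Notation B := (borelType V).
Local Notation lam := (lebesgue_rV d).

Lemma lebesgue_rV_le_box (a : 'I_d -> R) (s : 'I_d -> R) (T : set B) :
  measurable T -> (forall i, 0 <= s i) ->
  (forall v i, T v -> a i <= v 0 i <= a i + s i) ->
  (lam T <= (\prod_i s i)%:E)%E.
Proof.
move=> mT s0 Ta.
pose A i : set (measurableTypeR R) := `[a i, a i + s i]%classic.
have mA i : measurable (A i) by exact: measurable_itv.
apply: (@le_trans _ _ (lam [set v | forall i, A i (v 0 i)])).
  apply: le_measure; rewrite ?inE//; first exact: measurable_coord.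
  by move=> v Tv i; rewrite /A/= in_itv/=; exact: Ta.
rewrite lebesgue_rV_box// -prodEFin.
rewrite (eq_bigr (fun i => (s i)%:E)) // => i _.
rewrite /A lebesgue_measure_itv/= lte_fin ltrDl; case: ifPn => [_|].
  by rewrite -EFinB addrAC subrr add0r.
by rewrite -leNgt => si; congr EFin; apply/eqP; rewrite eq_le s0.
Qed.

(** The isodiametric inequality for the sup norm is trivial: a set of diameter s
    lies in a product of intervals of length s. *)
Lemma lebesgue_rV_diam (T : set B) (s : R) : measurable T -> 0 <= s ->
  (forall v w, T v -> T w -> `|v - w| <= s) -> (lam T <= (s ^+ d)%:E)%E.
Proof.
move=> mT s0 Ts.
have [->|/set0P[v0 Tv0]] := eqVneq T set0.
  by rewrite measure0 lee_fin exprn_ge0.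
pose X i := [set v 0 i | v in T].
have Xs v w i : T v -> T w -> v 0 i <= w 0 i + s.
  move=> Tv Tw; rewrite -lerBlDl; apply: le_trans (Ts v w Tv Tw).
  by apply: le_trans (ler_norm _) _; have := rV_norm_coord (v - w) i; rewrite !mxE.
have Xinf i : has_inf (X i).
  split; first by exists (v0 0 i), v0.
  exists (v0 0 i - s) => _ [w Tw <-]; rewrite lerBlDr; exact: Xs.
rewrite -[X in s ^+ X](card_ord d) -prodr_const.
apply: (@lebesgue_rV_le_box (fun i => inf (X i))) => // v i Tv; apply/andP; split.
  by apply: ge_inf; [have [] := Xinf i|exists v].
rewrite -lerBlDr; apply: lb_le_inf; first by have [] := Xinf i.
by move=> _ [w Tw <-]; rewrite lerBlDr; exact: Xs.
Qed.

(** The constant c^d is exact because, for the sup norm, the preimage of a cube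
    lies in a set of diameter c times the side of the cube. This is the only
    source of volume estimates for nonlinear maps below. *)
Lemma lebesgue_rV_expanding (S : set B) (phi : B -> B) (c : R) :
  measurable S -> measurable_fun S phi -> 0 <= c ->
  (forall v w, S v -> S w -> `|v - w : V| <= c * `|phi v - phi w : V|) ->
  forall A : set B, measurable A ->
  (lam (S `&` phi @^-1` A) <= (c ^+ d)%:E * lam A)%E.
Proof.
move=> mS mphi c0 Sc.
apply: (@le_measure_dyadic _ _ (image_measure lam mS mphi)).
  by rewrite exprn_ge0.
move=> k z; rewrite lebesgue_dyadic_cube -EFinM -exprMn /image_measure /=.
have k0 : 0 <= 2 ^- k :> R by rewrite invr_ge0 exprn_ge0.
apply: lebesgue_rV_diam.
- by apply: mphi => //; exact: measurable_dyadic_cube.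
- by rewrite mulr_ge0.
move=> v w [Sv vz] [Sw wz]; apply: le_trans (Sc _ _ Sv Sw) _.
apply: ler_wpM2l => //; apply: rV_norm_le => // j.
by rewrite !mxE; apply/ltW; exact: dyadic_cube_dist vz wz.
Qed.

End expanding.

Section linear.
Context {R : realType}.

(** An upper bound for the factor by which taking preimages under N multiplies
    volumes. One-sided bounds suffice, since they can be applied to the inverse
    matrix as well. *)
Definition mulmx_shrinks d (N : 'M[R]_d) (k : R) : Prop :=
  forall A : set (borelType 'rV[R]_d), measurable A ->
  (lebesgue_rV d ((fun v => v *m N) @^-1` A) <= k%:E * lebesgue_rV d A)%E.

Lemma measurable_preimage_mulmxr d (N : 'M[R]_d) (A : set (borelType 'rV[R]_d)) :
  measurable A ->
  measurable ((fun v : 'rV_d => v *m N) @^-1` A : set (borelType 'rV[R]_d)).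
Proof.
by move=> mA; rewrite -[X in measurable X]setTI; exact: measurable_mulmxr.
Qed.

Lemma mulmx_shrinksM d (N1 N2 : 'M[R]_d) k1 k2 : 0 <= k1 ->
  mulmx_shrinks N1 k1 -> mulmx_shrinks N2 k2 ->
  mulmx_shrinks (N1 *m N2) (k1 * k2).
Proof.
move=> k10 h1 h2 A mA.
rewrite (_ : _ @^-1` _ =
    (fun v => v *m N1) @^-1` ((fun v => v *m N2) @^-1` A)); last first.
  by apply/seteqP; split => v /=; rewrite mulmxA.
apply: le_trans (h1 _ _) _; first exact: measurable_preimage_mulmxr.
by rewrite EFinM -muleA; apply: lee_wpmul2l; rewrite ?lee_fin//; exact: h2.
Qed.

Lemma mulmx_shrinks_expanding d (N : 'M[R]_d) c : 0 <= c ->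
  (forall v : 'rV_d, `|v| <= c * `|v *m N|) -> mulmx_shrinks N (c ^+ d).
Proof.
move=> c0 Nc A mA; rewrite -[X in lebesgue_rV d X]setTI.
apply: (@lebesgue_rV_expanding _ _ setT (fun v : 'rV_d => v *m N)) => //.
  exact: measurable_mulmxr.
by move=> v w _ _; rewrite -mulmxBl; exact: Nc.
Qed.

Lemma mulmx_shrinks_diag d (D : 'rV[R]_d) : (forall i, D 0 i != 0) ->
  mulmx_shrinks (diag_mx D) (`|\prod_i D 0 i|^-1).
Proof.
move=> D0 A mA; rewrite -[X in lebesgue_rV d X]setTI.
apply: (@le_measure_dyadic _ _ (image_measure (lebesgue_rV d) measurableT
  (@measurable_mulmxr R d (diag_mx D)))) => //.
move=> k z; rewrite -[leLHS]/(lebesgue_rV d (setT `&` (fun v : 'rV_d => v *m diag_mx D)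
  @^-1` (dyadic_cube k z))) setTI lebesgue_dyadic_cube -EFinM.
rewrite (_ : _ * _ = \prod_i (2 ^- k / `|D 0 i|)); last first.
  rewrite big_split/= prodr_const card_ord mulrC normr_prod; congr (_ * _).
  by rewrite prodfV.
have k0 : 0 < 2 ^+ k :> R by rewrite exprn_gt0.
pose mid i := ((z 0 i)%:~R / 2 ^+ k + 2 ^- k / 2) / D 0 i.
apply: (@lebesgue_rV_le_box _ _ (fun i => mid i - 2 ^- k / `|D 0 i| / 2)).
- by apply: measurable_preimage_mulmxr; exact: measurable_dyadic_cube.
- by move=> i; rewrite divr_ge0// invr_ge0 ltW.
move=> v i; rewrite /= dyadic_cubeE => /(_ i).
have Di : 0 < `|D 0 i| by rewrite normr_gt0.
rewrite /dyadic_side /= in_itv/= mul_mx_diag mxE intrD mulrDl mul1r => /andP[h1 h2].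
suff : `|v 0 i - mid i| <= 2 ^- k / `|D 0 i| / 2.
  by rewrite ler_distl => /andP[h3 h4]; apply/andP; split => //; lra.
rewrite mulrAC ler_pdivlMr// -normrM mulrBl divfK//.
by rewrite ler_distl; apply/andP; split; lra.
Qed.

(** Conjugation by the diagonal matrix with entries t^(w i) multiplies each
    off-diagonal entry by a positive power of t and leaves volumes alone. As t
    tends to 0 the conjugate tends to the identity, which expands by almost 1.
    The weight w covers lower and upper triangular matrices together. *)
Lemma mulmx_shrinks_unitriangular d (N : 'M[R]_d) (w : 'I_d -> nat) :
  (forall i, N i i = 1) ->
  (forall i j, i != j -> N i j != 0 -> (w i < w j)%N) ->
  mulmx_shrinks N 1.
Proof.
move=> N1 Nw A mA; rewrite mul1e; apply: lee_mul_near1 => // e /exprn_le_near1.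
move=> /(_ d)[c c1 ce]; apply: le_trans (_ : (_ <= (c ^+ d)%:E * _)%E) _; last first.
  by apply: lee_wpmul2r; rewrite ?lee_fin.
move: A mA; rewrite -/(mulmx_shrinks _ _).
have c0 : 0 < c by lra.
have [C C0 NC] : exists2 C : R, 0 < C & forall i j, `|N i j| <= C.
  exists (1 + \sum_i \sum_j `|N i j|) => [|i j].
    by rewrite ltr_wpDr//; apply: sumr_ge0 => i _; apply: sumr_ge0.
  rewrite (bigD1 i)//= (bigD1 j)//= addrA addrA [1 + _]addrC -!addrA lerDl.
  rewrite !addr_ge0//; first by apply: sumr_ge0.
  by apply: sumr_ge0 => k _; apply: sumr_ge0.
(* off-diagonal entries at most t C make the conjugate differ from the identity
   by at most eps in norm, so that it expands by at least 1 - eps = 1 / c *)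
pose eps := 1 - c^-1.
have eps0 : 0 < eps by rewrite subr_gt0 invf_lt1.
pose t := Num.min 1 (eps / (d%:R * C + 1)).
have dC0 : 0 < d%:R * C + 1 by rewrite ltr_wpDl// mulr_ge0// ltW.
have t0 : 0 < t by rewrite lt_min ltr01 divr_gt0.
have t1 : t <= 1 by rewrite ge_min lexx.
have te : t * (d%:R * C + 1) <= eps.
  by rewrite -ler_pdivlMr// ge_min lexx orbT.
pose D := \row_i (t ^+ w i); pose D' := \row_i (t ^- w i).
pose Nt := \matrix_(i, j) (t ^- w i * N i j * t ^+ w j).
have tw i : t ^+ w i != 0 by rewrite expf_neq0// gt_eqF.
have NE : N = diag_mx D *m Nt *m diag_mx D'.
  apply/matrixP => i j; rewrite mul_mx_diag mxE mul_diag_mx !mxE.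
  by rewrite !mulrA mulfV// mul1r mulfK.
have D0 i : D 0 i != 0 by rewrite mxE.
have D'0 i : D' 0 i != 0 by rewrite mxE invr_neq0.
have -> : c ^+ d = `|\prod_i D 0 i|^-1 * c ^+ d * `|\prod_i D' 0 i|^-1.
  rewrite mulrAC -invfM -normrM -big_split/= big1 ?normr1 ?invr1 ?mul1r// => i _.
  by rewrite !mxE divff.
rewrite NE; apply: mulmx_shrinksM; last exact: mulmx_shrinks_diag.
  by rewrite mulr_ge0// ?invr_ge0// exprn_ge0// ltW.
apply: mulmx_shrinksM; [by rewrite invr_ge0|exact: mulmx_shrinks_diag|].
apply: mulmx_shrinks_expanding; first exact: ltW.
move=> v.
have NtE : `|v *m (1%:M - Nt)| <= eps * `|v|.
  apply: le_trans (@rV_norm_mulmx _ _ _ _ (t * C) _ _) _.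
  - by rewrite mulr_ge0// ltW.
  - move=> i j; rewrite !mxE; have [<-|ij] := eqVneq i j.
      rewrite N1 mulr1 mulVf// subrr normr0 mulr_ge0//; exact: ltW.
    rewrite sub0r normrN; have [->|Nij] := eqVneq (N i j) 0.
      by rewrite mulr0 mul0r normr0 mulr_ge0// ltW.
    have wij := Nw _ _ ij Nij.
    rewrite mulrAC normrM; apply: ler_pM => //.
    rewrite -(subnK (ltnW wij)) exprD mulrCA mulVf// mulr1.
    rewrite ger0_norm; last by rewrite exprn_ge0// ltW.
    rewrite -[leRHS]expr1; apply: ler_wiXn2l => //; first exact: ltW.
    by rewrite subn_gt0.
  - apply: ler_wpM2r => //; apply: le_trans te.
    by rewrite mulrCA ler_wpM2l// ?lerDl// ltW.
have : `|v| <= `|v *m Nt| + eps * `|v|.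
  rewrite -{1}(subrK (v *m Nt) v) addrC; apply: le_trans (ler_normD _ _) _.
  by rewrite lerD2l -{1}[v]mulmx1 -mulmxBr.
rewrite -lerBlDr -[X in X - _]mul1r -mulrBl /eps subKr => h.
by rewrite mulrC -ler_pdivrMr// mulrC.
Qed.

Lemma mulmx_shrinks_perm d (s : 'S_d) : mulmx_shrinks (perm_mx s : 'M[R]_d) 1.
Proof.
rewrite -[1](expr1n _ d); apply: mulmx_shrinks_expanding => // v.
rewrite mul1r; apply: rV_norm_le => // j.
rewrite (_ : v 0 j = (v *m perm_mx s) 0 (s j)); first exact: rV_norm_coord.
by rewrite -[s]invgK -col_permE mxE invgK permK.
Qed.

(** By LU decomposition: permutation and unitriangular factors preserve volume,
    and the diagonal factor carries the determinant. *)
Lemma mulmx_shrinks_det d (N : 'M[R]_d) : N \in unitmx ->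
  mulmx_shrinks N (`|\det N|^-1).
Proof.
case: d N => [N _ A mA|d N].
  rewrite det_mx00 normr1 invr1 mul1e (_ : _ @^-1` _ = A)//.
  by apply/seteqP; split => v /=; rewrite (thinmx0 (v *m N)) (thinmx0 v).
have := cormen_lup_perm N; have := cormen_lup_correct N.
have := cormen_lup_detL N; have := @cormen_lup_lower _ _ N.
have := @cormen_lup_upper _ _ N.
case: (cormen_lup N) => [[P L] U]/= Uu Ll detL PN /is_perm_mxP[s Ps] uN.
have NE : N = perm_mx s^-1%g *m (L *m U).
  by rewrite -[L *m U]PN Ps mulmxA -perm_mxM mulVg perm_mx1 mul1mx.
have detU : \det U = \prod_i U i i.
  rewrite -det_tr det_trig; last by apply/is_trig_mxP => i j ij; rewrite mxE Uu.
  by apply: eq_bigr => i _; rewrite mxE.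
have detN : `|\det N| = `|\prod_i U i i|.
  rewrite NE !det_mulmx detL mul1r detU normrM det_perm normrX normrN1 expr1n.
  by rewrite mul1r.
have U0 i : U i i != 0.
  have : `|\det N| != 0 by rewrite normr_eq0 -unitfE -unitmxE.
  by rewrite detN normr_eq0 prodf_seq_neq0 => /allP; apply; rewrite mem_index_enum.
pose D := \row_i U i i; pose U' := \matrix_(i, j) ((U i i)^-1 * U i j).
have UE : U = diag_mx D *m U'.
  by apply/matrixP => i j; rewrite mul_diag_mx !mxE mulrA mulfV// mul1r.
rewrite NE UE [X in mulmx_shrinks X](_ : _ =
   perm_mx s^-1%g *m L *m diag_mx D *m U'); last by rewrite !mulmxA.
rewrite (_ : `|\det _|^-1 = 1 * 1 * `|\prod_i D 0 i|^-1 * 1); last first.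
  rewrite -UE -NE detN !mul1r mulr1; congr (`|_|^-1).
  by apply: eq_bigr => i _; rewrite mxE.
apply: mulmx_shrinksM; first by rewrite !mul1r invr_ge0.
  apply: mulmx_shrinksM; first by rewrite mul1r.
    apply: mulmx_shrinksM => //; first exact: mulmx_shrinks_perm.
    apply: (@mulmx_shrinks_unitriangular _ _ (fun i => d - i)%N).
      by move=> i; rewrite Ll// eqxx.
    move=> i j ij; have [lij|lji _] := leqP i j.
      by rewrite Ll// (negbTE ij) eqxx.
    by rewrite ltn_sub2l// (leq_trans lji)// -ltnS.
  by apply: mulmx_shrinks_diag => i; rewrite mxE.
apply: (@mulmx_shrinks_unitriangular _ _ (@nat_of_ord _)).
  by move=> i; rewrite mxE mulVf.
move=> i j ij; rewrite mxE; have [//|ji] := ltnP i j.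
rewrite (Uu i j) ?mulr0 ?eqxx//.
by rewrite ltn_neqAle ji andbT eq_sym.
Qed.

End linear.

(** * Continuously differentiable maps and linear frames *)

Section strict_differentiability.
Context {R : realType} {d : nat}.
Local Notation V := 'rV[R]_d.

Lemma sub_entry (M N : 'M[R]_d) i j : (M - N) i j = M i j - N i j.
Proof. by rewrite !mxE. Qed.

Lemma nbhs_entries (J : 'M[R]_d) (e : R) : 0 < e ->
  nbhs J [set N : 'M[R]_d | forall i j, `|N i j - J i j| < e].
Proof.
move=> e0; apply/nbhs_ballP; exists e => // N [_ JN] i j.
by have := JN i j; rewrite /ball/= distrC.
Qed.

Lemma is_derive_segment (g : V -> V) (b v : V) (t : R) j :
  differentiable g (b + t *: v) ->
  is_derive t 1 (fun s => g (b + s *: v) 0 j)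
    ((v *m jacobian g (b + t *: v)) 0 j).
Proof.
move=> dg; set p := b + t *: v.
have := @diff_derivable _ _ _ _ _ v dg; rewrite /derivable => cg.
have gE := deriveEjacobian v dg.
have {}cg : h^-1 *: ((g \o shift p) (h *: v) - g p) @[h --> 0^'] --> v *m jacobian g p.
  by rewrite -gE; exact: cg.
have cgj := @cvg_comp _ _ _ _ (fun N : V => N 0 j) _ _ _ cg
  (@coord_continuous R 1 d 0 j (v *m jacobian g p)).
have cphi : h^-1 *: (((fun s => g (b + s *: v) 0 j) \o shift t) (h *: (1 : R))
    - g p 0 j) @[h --> 0^'] --> (v *m jacobian g p) 0 j.
  rewrite (_ : (fun h => _) = (fun N : V => N 0 j) \o
    (fun h => h^-1 *: ((g \o shift p) (h *: v) - g p))) //.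
  apply/funext => h; rewrite /= !mxE /=; congr (h^-1 * (g _ 0 j - _)).
  by rewrite /p [h *: 1]mulr1 scalerDl addrCA.
apply: DeriveDef; first by apply/cvg_ex; exists ((v *m jacobian g p) 0 j).
exact: cvg_lim cphi.
Qed.

(** The mean value theorem along the segment from b to a, one coordinate at a
    time; the intermediate point may depend on the coordinate, but the Jacobian
    is nearly constant on the whole ball. *)
Lemma C1_strictly_differentiable (O : set V) (g : V -> V) (y : V) (e : R) :
  open O -> (forall x, O x -> differentiable g x) -> O y ->
  {for y, continuous (jacobian g)} -> 0 < e ->
  exists r : R, [/\ 0 < r, ball y r `<=` O & forall a b, ball y r a ->
    ball y r b -> `|g a - g b - (a - b) *m jacobian g y| <= e * `|a - b|].
Proof.
move=> oO dg Oy cJ e0.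
pose e' := e / (d%:R + 1).
have d1 : 0 < d%:R + 1 :> R by rewrite ltr_wpDl.
have e'0 : 0 < e' by rewrite divr_gt0.
have : nbhs y (O `&` [set x | forall i j, `|jacobian g x i j - jacobian g y i j| < e']).
  apply: filterI; first by move: oO; rewrite openE; exact.
  exact: (cJ _ (nbhs_entries (jacobian g y) e'0)).
move=> /nbhs_ballP[r/= r0 rO]; exists r; split=> //.
  by move=> x /rO[].
move=> a b ya yb; set v := a - b.
have seg (t : R) : 0 <= t <= 1 -> ball y r (b + t *: v).
  move=> /andP[t0 t1]; move: ya yb; rewrite -!ball_normE /= => ya yb.
  have -> : y - (b + t *: v) = (1 - t) *: (y - b) + t *: (y - a).
    rewrite /v !scalerBr scalerBl !scale1r scalerBl scale1r.
    by apply/rowP => i; rewrite !mxE; lra.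
  apply: le_lt_trans (ler_normD _ _) _; rewrite !normrZ.
  rewrite (ger0_norm t0) ger0_norm ?subr_ge0//.
  have [->|t_neq] := eqVneq t 0; first by rewrite subr0 mul1r mul0r addr0.
  have {t_neq} t0' : 0 < t by rewrite lt_neqAle eq_sym t_neq.
  have h1 : (1 - t) * `|y - b| <= (1 - t) * r.
    by rewrite ler_wpM2l ?subr_ge0// ltW.
  have h2 : t * `|y - a| < t * r by rewrite ltr_pM2l.
  lra.
apply: rV_norm_le => [|j]; first by rewrite mulr_ge0// ltW.
pose phi (s : R) : R := g (b + s *: v) 0 j.
have dphi (t : R) : 0 <= t <= 1 ->
    is_derive t 1 phi ((v *m jacobian g (b + t *: v)) 0 j).
  by move=> /seg /rO[? _]; apply: is_derive_segment; exact: dg.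
have [|||t] := @MVT R phi (fun t => (v *m jacobian g (b + t *: v)) 0 j) 0 1.
- exact: ltr01.
- by move=> t; rewrite in_itv/= => /andP[? ?]; apply: dphi; rewrite !ltW.
- apply: derivable_within_continuous => t; rewrite in_itv/= => t01.
  by have [] := dphi t t01.
rewrite in_itv/= => /andP[t0 t1]; rewrite subr0 mulr1 /phi.
have bv : b + v = a by rewrite /v addrC subrK.
rewrite scale1r scale0r addr0 bv => gE.
have hJ i k : `|(jacobian g (b + t *: v) - jacobian g y) i k| <= e'.
  have [|_ /(_ i k)] := rO (b + t *: v); first by apply: seg; rewrite !ltW.
  by rewrite sub_entry => /ltW.
move: gE hJ; move: (jacobian g (b + t *: v)) (jacobian g y) => Jt Jy gE hJ.
have -> : (g a - g b - v *m Jy) 0 j = (v *m (Jt - Jy)) 0 j.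
  move: gE; rewrite mulmxBr; move: (v *m Jt) (v *m Jy) => w w' gE.
  by rewrite !mxE gE.
apply: le_trans (rV_norm_coord _ _) _.
apply: le_trans (rV_norm_mulmx _ (ltW e'0) hJ) _.
apply: ler_wpM2r => //.
by rewrite /e' mulrCA ger_pMr// ler_pdivrMr//; lra.
Qed.

End strict_differentiability.

Section det_scaling.
Context {R : realType} {d : nat}.
Implicit Types A N : 'M[R]_d.

(** An invertible frame N in which A does not increase norms, with |det N| as
    close to |det A| as desired. If A is invertible, N is A itself. If A is
    singular, its image is at most a hyperplane in suitable coordinates, and
    shrinking N along the missing direction makes |det N| arbitrarily small
    without affecting the norm of A seen through N. This is how the image of the
    critical set of a map turns out to be negligible. *)
Lemma det_upper_frame A (e : R) : `|\det A| < e ->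
  exists N c, [/\ N \in unitmx, 1 < c, c ^+ d * `|\det N| <= e &
    forall v : 'rV_d, `|v *m A *m invmx N| <= `|v|].
Proof.
move=> Ae; have e0 : 0 < e by apply: le_lt_trans Ae.
have [uA|nuA] := boolP (A \in unitmx).
  have A0 : 0 < `|\det A| by rewrite normr_gt0 -unitfE -unitmxE.
  have [|c c1 ce] := @exprn_le_near1 R d (e / `|\det A|).
    by rewrite ltr_pdivlMr// mul1r.
  exists A, c; split=> //; first by rewrite -ler_pdivlMr.
  by move=> v; rewrite mulmxK.
have rA : (\rank A < d)%N.
  by rewrite ltn_neqAle rank_leq_row andbT; move: nuA; rewrite -row_full_unit.
pose r := Ordinal rA.
have [C C0 hC] := rV_norm_mulmx_bounded (col_ebase A *m pid_mx (\rank A)).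
pose Q := `|\det (row_ebase A)|.
(* with c = 2, the condition on the determinant reads 2^d C^d Q / s' <= e *)
pose s := 2 ^+ d * C ^+ d * Q / e.
pose s' := s + 1.
have s0 : 0 <= s.
  apply: divr_ge0; last exact: ltW.
  by rewrite !(mulr_ge0, exprn_ge0, normr_ge0)// ltW.
pose D := \row_i (C * if i == r then s'^-1 else 1).
pose D' := \row_i (C^-1 * if i == r then s' else 1).
have s'0 : s' != 0 by rewrite gt_eqF// ltr_wpDl.
have C0' : C != 0 by rewrite gt_eqF.
have DD' : diag_mx D *m diag_mx D' = 1%:M.
  apply/matrixP => i j; rewrite mul_diag_mx !mxE.
  case: (eqVneq i j) => [_|ij]; last by rewrite !mulr0n mulr0.
  by rewrite !mulr1n mulrACA mulfV// mul1r; case: ifP => _; rewrite ?mulVf// mulr1.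
have DU : diag_mx D *m row_ebase A \in unitmx.
  rewrite unitmx_mul row_ebase_unit andbT.
  by have [] := mulmx1_unit DD'.
have invD : invmx (diag_mx D) = diag_mx D'.
  have [uD _] := mulmx1_unit DD'.
  by rewrite -[RHS](mulKmx uD) DD' mulmx1.
exists (diag_mx D *m row_ebase A), 2; split=> //.
- by rewrite ltr1n.
- rewrite det_mulmx det_diag normrM -/Q.
  have -> : \prod_i D 0 i = C ^+ d * s'^-1.
    rewrite (eq_bigr (fun i => C * if i == r then s'^-1 else 1)); last first.
      by move=> i _; rewrite mxE.
    rewrite big_split/= prodr_const card_ord; congr (_ * _).
    by rewrite -big_mkcond/= big_pred1_eq.
  rewrite ger0_norm; last by rewrite mulr_ge0 ?exprn_ge0 ?invr_ge0 ?ltW// ltr_wpDl.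
  rewrite !mulrA mulrAC ler_pdivrMr ?ltr_wpDl//.
  rewrite [leRHS](_ : _ = 2 ^+ d * C ^+ d * Q + e); last first.
    by rewrite /s' /s mulrDr mulr1 mulrC divfK// gt_eqF.
  by rewrite lerDl ltW.
move=> v; rewrite -[A in v *m A]mulmx_ebase.
have -> : invmx (diag_mx D *m row_ebase A) = invmx (row_ebase A) *m diag_mx D'.
  have uR := row_ebase_unit A.
  apply: (can_inj (mulKmx DU)); rewrite mulmxV//.
  by rewrite mulmxA mulmxK// DD'.
rewrite !mulmxA mulmxK ?row_ebase_unit// -!mulmxA.
have -> : pid_mx (\rank A) *m diag_mx D' = C^-1 *: (pid_mx (\rank A) : 'M[R]_d).
  apply/matrixP => i j; rewrite mul_mx_diag !mxE.
  case: (eqVneq (i : nat) j) => [ij|_]; last by rewrite andFb !mulr0n mul0r mulr0.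
  case: (ltnP i (\rank A)) => [ir|_]; last by rewrite andbF !mulr0n mul0r mulr0.
  rewrite ifF ?mulr1 ?mul1r//; apply/negbTE; apply: contraTneq ir => jr.
  by rewrite ij jr /= ltnn.
rewrite -scalemxAr -scalemxAr normrZ ger0_norm; last by rewrite invr_ge0 ltW.
by rewrite ler_pdivrMl.
Qed.

End det_scaling.

(** * Local comparison of an image measure with Lebesgue measure *)

Section local_area.
Context {R : realType} {d : nat}.
Local Notation V := 'rV[R]_d.
Local Notation B := (borelType V).
Local Notation lam := (lebesgue_rV d).
Variables (S : set B) (f : B -> B) (O : set V) (g : V -> V).
Hypotheses (mS : measurable S) (mf : measurable_fun S f).
Hypotheses (oO : open O) (fg : forall y, O y -> S (g y) /\ f (g y) = y).
Hypotheses (fO : forall x, S x -> O (f x) /\ g (f x) = x).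
Hypothesis C1g : forall y, O y ->
  differentiable g y /\ {for y, continuous (jacobian g)}.

Let nu := image_measure lam mS mf.

Let dg y : O y -> differentiable g y. Proof. by move=> /C1g[]. Qed.

(** Read in the coordinates given by the frame N, the map g has Lipschitz
    constant at most c near y, so that its inverse f expands by 1/c. *)
Lemma image_measure_local_le y (e : R) : O y -> `|\det (jacobian g y)| < e ->
  exists r : R, 0 < r /\ forall A : set B, measurable A -> A `<=` ball (y : V) r ->
    (nu A <= e%:E * lam A)%E.
Proof.
move=> Oy /det_upper_frame[N [c [uN c1 ce Nv]]].
have c0 : 0 < c by lra.
have [C C0 hC] := rV_norm_mulmx_bounded (invmx N).
have [|r [r0 rO hr]] := @C1_strictly_differentiable _ _ O g y ((c - 1) / C) oO
  dg Oy (C1g Oy).2.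
  by rewrite divr_gt0// subr_gt0.
exists r; split=> // A mA Ar.
pose T : set B := S `&` f @^-1` A.
have mT : measurable T by exact: mf.
pose S' : set B := (fun z : V => z *m N) @^-1` (S `&` f @^-1` ball (y : V) r).
have mball : measurable (ball (y : V) r : set B).
  by apply: borel_open_measurable; exact: ball_open.
have mS' : measurable S'.
  by apply: measurable_preimage_mulmxr; exact: mf.
pose phi (z : B) : B := f ((z : V) *m N).
have mphi : measurable_fun S' phi.
  apply: (@measurable_comp _ _ _ _ _ _ S f S' (fun z : V => z *m N : B)) => //.
    by move=> _ [z [Sz _] <-].
  by apply: measurable_funTS; exact: measurable_mulmxr.
have key : (lam (S' `&` phi @^-1` A) <= (c ^+ d)%:E * lam A)%E.
  apply: lebesgue_rV_expanding => //; first exact: ltW.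
  move=> z w [Sz yz] [Sw yw].
  have zE : z = g (phi z) *m invmx N by rewrite /phi (fO Sz).2 mulmxK.
  have wE : w = g (phi w) *m invmx N by rewrite /phi (fO Sw).2 mulmxK.
  have -> : (z : V) - w = (phi z - phi w : V) *m jacobian g y *m invmx N +
      (g (phi z) - g (phi w) - (phi z - phi w : V) *m jacobian g y) *m invmx N.
    by rewrite -mulmxDl [X in X *m _]addrC subrK mulmxBl -zE -wE.
  apply: le_trans (ler_normD _ _) _.
  have h1 := Nv (phi z - phi w : V).
  have h2 := hC (g (phi z) - g (phi w) - (phi z - phi w : V) *m jacobian g y).
  have h3 := hr _ _ yz yw.
  apply: le_trans (lerD h1 (le_trans h2 (ler_wpM2l (ltW C0) h3))) _.
  by rewrite mulrA mulrCA mulfV ?gt_eqF// mulr1 mulrBl mul1r addrC subrK.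
have TE : T = (fun x : V => x *m invmx N) @^-1` (S' `&` phi @^-1` A).
  rewrite /S' /phi; apply/seteqP; split => x /=; rewrite mulmxKV//.
    by move=> [Sx Ax]; split=> //; split=> //; exact: Ar.
  by move=> [[Sx _] Ax].
rewrite -[nu A]/(lam T) TE.
have uN' : invmx N \in unitmx by rewrite unitmx_inv.
apply: le_trans (mulmx_shrinks_det uN' _) _.
  by apply: mphi => //.
rewrite det_inv normfV invrK.
apply: (@le_trans _ _ (`|\det N|%:E * ((c ^+ d)%:E * lam A))%E).
  by apply: lee_wpmul2l; rewrite ?lee_fin.
rewrite muleA -EFinM mulrC; apply: lee_wpmul2r => //; exact: measure_ge0.
Qed.

(** If det Dg(y) is at most e in absolute value, the bound is trivial.
    Otherwise g followed by the inverse of Dg(y) is close to the identity, hence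
    expands by almost 1 near y. The additive form of the error keeps the bound
    meaningful at critical points. *)
Lemma image_measure_local_ge y (e : R) : O y -> 0 < e ->
  exists r : R, 0 < r /\ forall A : set B, measurable A -> A `<=` ball (y : V) r ->
    (`|\det (jacobian g y)|%:E * lam A <= nu A + e%:E * lam A)%E.
Proof.
move=> Oy e0; set J := jacobian g y.
have [le_e|lt_e] := leP `|\det J| e.
  exists 1; split=> // A mA _; apply: (@le_trans _ _ (e%:E * lam A)%E).
    by apply: lee_wpmul2r; rewrite ?lee_fin.
  by rewrite leeDr.
have e1 : 0 < `|\det J| - e by rewrite subr_gt0.
have J0 : 0 < `|\det J| by apply: lt_trans lt_e.
have uJ : J \in unitmx by rewrite unitmxE unitfE -normr_gt0.
have [|c c1 ce] := @exprn_le_near1 R d (`|\det J| / (`|\det J| - e)).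
  by rewrite ltr_pdivlMr// mul1r; lra.
have c0 : 0 < c by lra.
have [C C0 hC] := rV_norm_mulmx_bounded (invmx J).
have c1' : 0 < 1 - c^-1 by rewrite subr_gt0 invf_lt1.
have [|r [r0 rO hr]] := @C1_strictly_differentiable _ _ O g y ((1 - c^-1) / C) oO
  dg Oy (C1g Oy).2.
  by rewrite divr_gt0.
rewrite -/J in hr; clearbody J.
exists r; split=> // A mA Ar.
pose U : set B := ball (y : V) r.
have oU : open (U : set V) by exact: ball_open.
have mU : measurable U by exact: borel_open_measurable.
pose h (x : B) : B := g x *m invmx J.
have mh : measurable_fun U h.
  apply: (@measurable_fun_continuous_open V V U h oU).
  move=> x /rO Ox.
  apply: (@continuous_comp _ _ _ g (fun z : V => z *m invmx J)).
    by apply: differentiable_continuous; exact: dg.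
  exact: continuous_mulmxr.
pose T : set B := S `&` f @^-1` A.
have mT : measurable T by exact: mf.
pose T' : set B := (fun z : V => z *m J) @^-1` T.
have mT' : measurable T' := measurable_preimage_mulmxr J mT.
have key : (lam (U `&` h @^-1` T') <= (c ^+ d)%:E * lam T')%E.
  apply: lebesgue_rV_expanding => //; first exact: ltW.
  move=> a b Ua Ub; have := hr _ _ Ua Ub; move: ((a : V) - b) => v h1.
  have h2 := hC (g a - g b - v *m J).
  have {h1 h2} h3 := le_trans h2 (ler_wpM2l (ltW C0) h1).
  have hE : v = (h a - h b : V) - (g a - g b - v *m J) *m invmx J.
    rewrite mulmxBl mulmxK// mulmxBl /h opprB.
    by rewrite [RHS]addrC subrK.
  have : `|v| <= `|h a - h b : V| + (1 - c^-1) * `|v|.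
    rewrite {1}hE; apply: le_trans (ler_normB _ _) _; rewrite lerD2l.
    apply: le_trans h3 _.
    by rewrite mulrA mulrCA mulfV ?gt_eqF// mulr1.
  rewrite mulrBl mul1r => h4.
  rewrite mulrC -ler_pdivrMr// mulrC; lra.
have AE : A = U `&` h @^-1` T'.
  apply/seteqP; split => a /=.
    move=> Aa; have Oa := rO _ (Ar _ Aa); split; first exact: Ar.
    rewrite /T' /h /= mulmxKV//; have [? fga] := fg Oa.
    by split=> //; rewrite /preimage/= fga.
  move=> [Ua]; rewrite /T' /h /= mulmxKV// => -[_] /=.
  by rewrite (fg (rO _ Ua)).2.
have h1 : (lam A <= (c ^+ d)%:E * (`|\det J|^-1%:E * nu A))%E.
  rewrite {1}AE; apply: le_trans key _.
  apply: lee_wpmul2l; first by rewrite lee_fin exprn_ge0// ltW.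
  exact: mulmx_shrinks_det.
have h2 : ((`|\det J| - e)%:E * lam A <= nu A)%E.
  apply: le_trans (lee_wpmul2l _ h1) _; first by rewrite lee_fin ltW.
  rewrite !muleA -!EFinM -[leRHS]mul1e; apply: lee_wpmul2r => //.
  rewrite lee_fin ler_pdivrMr// mul1r mulrC -ler_pdivlMr//.
rewrite -{1}[`|\det J|](subrK e) EFinD ge0_muleDl ?lee_fin//; [|exact: ltW..].
by rewrite leeD2r.
Qed.

End local_area.

(** * From local bounds to a density *)

Section integral_measure.
Context d (T : measurableType d) (R : realType).
Variables (mu : {measure set T -> \bar R}) (f : T -> \bar R).
Hypotheses (mf : measurable_fun setT f) (f0 : forall x, (0 <= f x)%E).

(** As for image measures, the proofs are arguments so that the set function
    carries its measure structure. *)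
Definition integral_measure of measurable_fun setT f &
  (forall x, (0 <= f x)%E) := fun A : set T => (\int[mu]_(x in A) f x)%E.

Local Notation nu := (integral_measure mf f0).

Let nu0 : nu set0 = 0%E. Proof. exact: integral_set0. Qed.

Let nu_ge0 A : (0 <= nu A)%E. Proof. by apply: integral_ge0 => x _. Qed.

Let nu_sigma : semi_sigma_additive nu.
Proof.
move=> F mF tF mUF; rewrite /integral_measure ge0_integral_bigcup//; last first.
  exact: measurable_funTS.
by apply: is_cvg_nneseries => n _ _; exact: integral_ge0.
Qed.

HB.instance Definition _ := isMeasure.Build _ _ _ nu nu0 nu_ge0 nu_sigma.

End integral_measure.

Section local_to_global.
Context {R : realType} {d : nat}.
Local Notation V := 'rV[R]_d.
Local Notation B := (borelType V).
Local Notation lam := (lebesgue_rV d).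

(** Countably many rational balls, on each of which the inequality holds, cover
    O; cutting A along the disjoint sets that they generate makes the inequality
    additive. *)
Lemma le_measure_local (m1 m2 : {measure set B -> \bar R}) (O : set B) :
  (forall y, O y -> exists r : R, 0 < r /\ forall A : set B, measurable A ->
    A `<=` ball (y : V) r -> A `<=` O -> (m1 A <= m2 A)%E) ->
  forall A : set B, measurable A -> A `<=` O -> (m1 A <= m2 A)%E.
Proof.
move=> loc A mA AO.
pose qball (p : 'rV[rat]_d * nat) : set B :=
  ball (map_mx ratr p.1 : V) p.2.+1%:R^-1.
have mqball p : measurable (qball p).
  by apply: borel_open_measurable; exact: ball_open.
pose good p := forall C : set B, measurable C -> C `<=` qball p ->
  C `<=` O -> (m1 C <= m2 C)%E.
pose E n : set B := if unpickle n is Some p then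
  if `[< good p >] then qball p else set0 else set0.
have mE n : measurable (E n).
  by rewrite /E; case: unpickle => // p; case: asboolP.
have goodE n C : measurable C -> C `<=` E n -> C `<=` O -> (m1 C <= m2 C)%E.
  rewrite /E => mC; have nul : C `<=` set0 -> (m1 C <= m2 C)%E.
    by rewrite subset0 => ->; rewrite !measure0.
  case: unpickle => [p|] CE CO; last exact: nul.
  by move: CE; case: asboolP => [gp CE|_ CE]; [exact: gp|exact: nul].
have OE : O `<=` \bigcup_n E n.
  move=> y Oy; have [r [r0 hr]] := loc y Oy.
  have oB : open (ball (y : V) r) by exact: ball_open.
  have := @ballxx R V y r r0; rewrite {1}(open_rV_rat oB) => -[p /= pB py].
  exists (pickle p) => //; rewrite /E pickleK asboolT//.
  by move=> C mC Cp; apply: hr => // x /Cp; exact: pB.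
have mF n : measurable (A `&` seqDU E n).
  by apply: measurableI => //; exact: seqDU_measurable.
have tF : trivIset setT (fun n => A `&` seqDU E n).
  by apply: trivIset_setIl; exact: trivIset_seqDU.
have -> : A = \bigcup_n (A `&` seqDU E n).
  rewrite -setI_bigcupr -seqDU_bigcup_eq.
  by apply/esym/setIidPl; exact: subset_trans OE.
rewrite !measure_bigcup//; apply: lee_nneseries => // n _.
apply: (@goodE n) => //; last by move=> x [/AO].
by move=> x [_]; exact: subset_seqDU.
Qed.

(** On a small ball around y, both nu A and the integral of w over A are within
    e lambda(A) of w(y) lambda(A). The resulting inequalities between measures
    are local, hence global, and e tends to 0 because O has finite measure. *)
Lemma density_of_local_bounds (nu : {measure set B -> \bar R}) (O : set B)
    (w : B -> R) : (lam O < +oo)%E -> measurable O ->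
  measurable_fun setT w -> (forall y, 0 <= w y) ->
  (forall y : V, O y -> {for y, continuous (w : V -> R)}) ->
  (forall y e, O y -> w y < e -> exists r : R, 0 < r /\
    forall A : set B, measurable A -> A `<=` ball (y : V) r ->
      (nu A <= e%:E * lam A)%E) ->
  (forall y e, O y -> 0 < e -> exists r : R, 0 < r /\
    forall A : set B, measurable A -> A `<=` ball (y : V) r ->
      ((w y)%:E * lam A <= nu A + e%:E * lam A)%E) ->
  forall A : set B, measurable A -> A `<=` O ->
    nu A = (\int[lam]_(x in A) (w x)%:E)%E.
Proof.
move=> finO mO mw w0 cw upper lower.
have cont y e : O y -> 0 < e -> exists2 r : R, 0 < r &
    forall x, ball (y : V) r x -> `|w x - w y| < e.
  move=> Oy e0; have : nbhs (w y) [set t | `|t - w y| < e].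
    by apply/nbhs_ballP; exists e => //= t; rewrite /ball/= distrC.
  by move=> /(cw y Oy) /nbhs_ballP[r /= r0 hr]; exists r.
have mew : measurable_fun setT (fun x => (w x)%:E) by exact/measurable_EFinP.
have w0' (x : B) : (0 <= (w x)%:E)%E by rewrite lee_fin.
have add e (A : set B) : 0 <= e -> measurable A ->
    (\int[lam]_(x in A) (w x + e)%:E = \int[lam]_(x in A) (w x)%:E + e%:E * lam A)%E.
  move=> e0 mA; rewrite -integral_cst//.
  rewrite -ge0_integralD//; first exact: measurable_funTS.
have finA (A : set B) : measurable A -> A `<=` O -> (lam A < +oo)%E.
  by move=> mA AO; apply: le_lt_trans finO; apply: le_measure; rewrite ?inE.
have absorb (x y : \bar R) (A : set B) : measurable A -> A `<=` O ->
    (forall e : R, 0 < e -> (x <= y + e%:E * lam A)%E) -> (x <= y)%E.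
  move=> mA AO xy; apply/lee_addgt0Pr => e e0.
  have fA : lam A \is a fin_num by rewrite ge0_fin_numE//; exact: finA.
  have lA1 : 0 < fine (lam A) + 1 by rewrite ltr_wpDl// fine_ge0.
  apply: le_trans (xy (e / (fine (lam A) + 1)) _) _; first by rewrite divr_gt0.
  rewrite leeD2l// -(fineK fA) -EFinM lee_fin mulrAC -mulrA ger_pMr//.
  by rewrite ler_pdivrMr// mul1r lerDl.
move=> A mA AO; apply/eqP; rewrite eq_le; apply/andP; split.
  apply: (absorb _ _ A) => // e e0; rewrite -add; [|exact: ltW|exact: mA].
  have mwe : measurable_fun setT (fun x => (w x + e)%:E).
    by apply/measurable_EFinP; exact: measurable_funD.
  have we0 x : (0 <= (w x + e)%:E)%E by rewrite lee_fin addr_ge0// ltW.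
  rewrite -[leRHS]/(integral_measure lam mwe we0 A).
  apply: (le_measure_local (m1 := nu)
    (m2 := integral_measure lam mwe we0) _ mA AO) => y Oy.
  have e20 : 0 < e / 2 by rewrite divr_gt0.
  have [r1 [r10 h1]] := upper y (w y + e / 2) Oy (ltac:(by rewrite ltrDl)).
  have [r2 r20 h2] := cont y (e / 2) Oy e20.
  exists (Num.min r1 r2); split; first by rewrite lt_min r10.
  move=> C mC CB CO; apply: le_trans (h1 C mC _) _.
    by apply: subset_trans CB _; apply: le_ball; rewrite ge_min lexx.
  rewrite -integral_cst//; apply: ge0_le_integral => //.
  - by move=> x _; rewrite lee_fin addr_ge0// ltW.
  - exact: measurable_funTS.
  move=> x /CB yx; rewrite lee_fin.
  have := h2 x; rewrite ltr_distl => /(_ _)/andP[|? ?]; last by lra.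
  by apply: le_ball yx; rewrite ge_min lexx orbT.
apply: (absorb _ _ A) => // e e0.
pose en := NngNum (ltW e0).
have -> : (nu A + e%:E * lam A = measure_add nu (mscale en lam) A)%E.
  by rewrite measure_addE.
rewrite -[leLHS]/(integral_measure lam mew w0' A).
apply: (le_measure_local (m1 := integral_measure lam mew w0')
  (m2 := measure_add nu (mscale en lam)) _ mA AO) => y Oy.
have e20 : 0 < e / 2 by rewrite divr_gt0.
have [r1 [r10 h1]] := lower y (e / 2) Oy e20.
have [r2 r20 h2] := cont y (e / 2) Oy e20.
exists (Num.min r1 r2); split; first by rewrite lt_min r10.
move=> C mC CB CO.
have C1 : C `<=` ball (y : V) r1.
  by apply: subset_trans CB _; apply: le_ball; rewrite ge_min lexx.
apply: (@le_trans _ _ (\int[lam]_(x in C) (w y + e / 2)%:E)%E).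
  apply: ge0_le_integral => //.
    exact: measurable_funTS.
  move=> x /CB yx; rewrite lee_fin.
  have := h2 x; rewrite ltr_distl => /(_ _)/andP[|? ?]; last by lra.
  by apply: le_ball yx; rewrite ge_min lexx orbT.
rewrite integral_cst// EFinD ge0_muleDl ?lee_fin//; last exact: ltW.
apply: le_trans (leeD2r _ (h1 C mC C1)) _.
rewrite [leRHS]measure_addE -addeA leeD2l// -ge0_muleDl ?lee_fin//; [|exact: ltW..].
by rewrite -EFinD -splitr.
Qed.

End local_to_global.

(** * The density of the image measure of an oscillating function *)

Lemma lebesgue_rV_compact (R : realType) d (K : set 'rV[R]_d) : compact K ->
  (lebesgue_rV d K < +oo)%E.
Proof.
move=> cK; have /compact_bounded[N [_ NK]] := cK.
pose n := (Num.truncn (`|N| + 1)).+1.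
apply: le_lt_trans (lebesgue_centered_box n); apply: le_measure; rewrite ?inE.
- exact: compact_measurable_rV.
- exact: measurable_centered_box.
move=> v Kv i; rewrite /= in_itv/= -ltr_norml.
apply: le_lt_trans (rV_norm_coord _ _) _.
apply: le_lt_trans (truncnS_gt _).
by apply: NK => //; rewrite ltr_pwDr// ler_norm.
Qed.

Lemma continuous_det (R : realType) d : continuous (fun N : 'M[R]_d => \det N).
Proof.
move=> N.
have csum (I : Type) (r : seq I) (F : I -> 'M[R]_d -> R) :
    (forall i, {for N, continuous (F i)}) ->
    {for N, continuous (fun M => \sum_(i <- r) F i M)}.
  move=> cF; elim: r => [|i r IH].
    rewrite (_ : (fun M => _) = cst 0); first exact: cst_continuous.
    by apply/funext => M; rewrite big_nil.
  rewrite (_ : (fun M => _) = (fun M => F i M + \sum_(j <- r) F j M)).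
    by apply: continuousD; [exact: cF|exact: IH].
  by apply/funext => M; rewrite big_cons.
have cprod (I : Type) (r : seq I) (F : I -> 'M[R]_d -> R) :
    (forall i, {for N, continuous (F i)}) ->
    {for N, continuous (fun M => \prod_(i <- r) F i M)}.
  move=> cF; elim: r => [|i r IH].
    rewrite (_ : (fun M => _) = cst 1); first exact: cst_continuous.
    by apply/funext => M; rewrite big_nil.
  rewrite (_ : (fun M => _) = (fun M => F i M * \prod_(j <- r) F j M)).
    by apply: continuousM; [exact: cF|exact: IH].
  by apply/funext => M; rewrite big_cons.
apply: (csum _ (index_enum {perm 'I_d})
  (fun s M => (-1) ^+ s * \prod_i M i (s i))) => s.
apply: continuousM; first exact: cst_continuous.
by apply: (cprod _ _ (fun i M => M i (s i))) => i; exact: coord_continuous.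
Qed.

Section oscillating_density.
Context {R : realType} {d : nat}.
Local Notation V := 'rV[R]_d.
Local Notation B := (borelType V).
Local Notation lam := (lebesgue_rV d).
Variables (Omega K : set V) (P : pieces R d) (f : V -> V).
Hypotheses (oOmega : open Omega) (cK : compact K).
Hypothesis fP : m_oscillating Omega K P f.

Let part_open i : open (part P i).
Proof. by have [[h _ _ _] _ _ _ _] := fP; have [] := h i. Qed.

Let img_open i : open (piece_img P i). Proof. by have [_ /(_ i)[]] := fP. Qed.

Let w i : B -> R := fun y => `|jac_inv P i y|.

Let w_out i y : ~ piece_img P i y -> w i y = 0.
Proof. by move=> Py; rewrite /w /jac_inv memNset// normr0. Qed.

Let w_in i y : piece_img P i y -> w i y = `|\det (jacobian (piece_inv P i) y)|.
Proof. by move=> Py; rewrite /w /jac_inv mem_set. Qed.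

Let w_continuous i (y : V) : piece_img P i y -> {for y, continuous (w i : V -> R)}.
Proof.
move=> Py; have [_ /(_ i)[_ _ _ /(_ y Py)[_ cJ] _] _ _ _] := fP.
have cdet : {for y, continuous (fun x => `|\det (jacobian (piece_inv P i) x)|)}.
  apply: (@continuous_comp _ _ _ (fun x => \det (jacobian (piece_inv P i) x)) Num.norm).
    apply: (@continuous_comp _ _ _ (jacobian (piece_inv P i)) (fun N => \det N)) => //.
    exact: continuous_det.
  exact: norm_continuous.
have nP : nbhs y (piece_img P i) by move: (@img_open i); rewrite openE; exact.
move=> W; rewrite (w_in Py) => /cdet nW.
have [e /= e0 eW] := (nbhs_ballP _ _).1 (filterI nP nW).
by apply/nbhs_ballP; exists e => //= x /eW[Px Wx]; rewrite /= (w_in Px).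
Qed.

Let w_measurable i : measurable_fun setT (w i).
Proof.
have mO : measurable (piece_img P i : set B).
  by apply: borel_open_measurable; exact: img_open.
rewrite -(setUv (piece_img P i)); apply/measurable_funU => //.
  exact: measurableC.
split.
  apply: measurable_fun_continuous_open_real; first exact: img_open.
  by move=> x; exact: w_continuous.
apply: (@eq_measurable_fun _ _ B (measurableTypeR R) _ (fun=> 0)).
  by move=> x; rewrite inE => /w_out ->.
exact: measurable_cst.
Qed.

Let mOmega : measurable (Omega : set B). Proof. exact: borel_open_measurable. Qed.

Let mpart i : measurable (part P i : set B).
Proof. by apply: borel_open_measurable; exact: part_open. Qed.

Let mf : @measurable_fun _ _ B B Omega f. Proof. by have [] := fP. Qed.

Let part_sub i : part P i `<=` Omega.
Proof. by have [[h _ _ _] _ _ _ _] := fP; have [] := h i. Qed.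

Let mfpart i : @measurable_fun _ _ B B (part P i) f.
Proof. by apply: measurable_funS mf => //; exact: part_sub. Qed.

(** The change of variables formula for one piece. The set S is the part and O
    its image, on which the inverse of the piece is continuously differentiable;
    off O both sides vanish. *)
Lemma piece_density i (A : set B) : measurable A ->
  lam (part P i `&` f @^-1` A) = (\int[lam]_(x in A) `|jac_inv P i x|%:E)%E.
Proof.
move=> mA; have [_ /(_ i)[PK Pinv oO C1 _] fE _ _] := fP.
have mO : measurable (piece_img P i : set B) by exact: borel_open_measurable.
have fO x : part P i x -> piece_img P i (f x) /\ piece_inv P i (f x) = x.
  by move=> Px; rewrite (fE i)//; split; [exists x|exact: Pinv].
have fg y : piece_img P i y -> part P i (piece_inv P i y) /\ f (piece_inv P i y) = y.
  by move=> [x Px <-]; rewrite Pinv//; split=> //; exact: fE.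
have finO : (lam (piece_img P i) < +oo)%E.
  apply: le_lt_trans (lebesgue_rV_compact cK); apply: le_measure; rewrite ?inE//.
    exact: compact_measurable_rV.
  by move=> _ [x Px <-]; exact: PK.
have mAO : measurable (A `&` piece_img P i : set B) by exact: measurableI.
have := @density_of_local_bounds R d (image_measure lam (mpart i) (@mfpart i))
  (piece_img P i) (w i) finO mO (@w_measurable i) (fun y => normr_ge0 _)
  (@w_continuous i).
move=> /(_ _ _ (A `&` piece_img P i) mAO) H.
rewrite (_ : (\int[lam]_(x in A) _)%E =
    (\int[lam]_(x in A `&` piece_img P i) (w i x)%:E)%E); last first.
  rewrite integral_mkcondr; apply: eq_integral => x _; rewrite patchE.
  by case: ifPn => //; rewrite notin_setE => /w_out; rewrite /w => ->.
rewrite -H.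
- rewrite /image_measure; congr (lam _); apply/seteqP; split=> x /=.
    by move=> [Px Afx]; split=> //; split=> //; have [] := fO x Px.
  by move=> [Px [Afx _]].
- move=> y e Oy; rewrite w_in// => we.
  exact: (image_measure_local_le (mpart i) (@mfpart i) oO fO C1 Oy we).
- move=> y e Oy e0; rewrite w_in//.
  exact: (image_measure_local_ge (mpart i) (@mfpart i) oO fg C1 Oy e0).
- by move=> x [].
Qed.

(** The restriction to the closure of the image is harmless, since the terms
    vanish off the image. *)
Lemma total_slopeE y : total_slope P y = (\sum_(i <oo) `|jac_inv P i y|%:E)%E.
Proof.
rewrite /total_slope eseries_mkcond; congr (limn _); apply/funext => n.
apply: eq_bigr => i _; case: ifPn => //; rewrite notin_setE => Ny.
rewrite /jac_inv memNset ?normr0// => Py; apply: Ny.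
exact: subset_closure.
Qed.

Lemma measurable_total_slope : measurable_fun setT (total_slope P : B -> \bar R).
Proof.
rewrite (_ : total_slope P = fun y => \sum_(i <oo) (w i y)%:E)%E; last first.
  by apply/funext => y; rewrite total_slopeE.
apply: ge0_emeasurable_sum => [i x _ _|i _]; first by rewrite lee_fin normr_ge0.
by apply/measurable_EFinP; exact: w_measurable.
Qed.

Lemma total_slope_ge0 y : (0 <= total_slope P y)%E.
Proof. by apply: nneseries_ge0 => i _ _; rewrite lee_fin. Qed.

Lemma oscillating_density (A : set B) : measurable A ->
  lam (Omega `&` f @^-1` A) = (\int[lam]_(x in A) total_slope P x)%E.
Proof.
move=> mA; have [[_ tP _ null] _ _ _ _] := fP.
have mU : measurable (\bigcup_i part P i : set B) by exact: bigcup_measurable.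
have mOA : measurable (Omega `&` f @^-1` A : set B) by exact: mf.
have -> : lam (Omega `&` f @^-1` A) =
    (lam ((Omega `&` f @^-1` A) `\` \bigcup_i part P i) +
     lam ((Omega `&` f @^-1` A) `&` \bigcup_i part P i))%E.
  exact: (measureDI lam mOA mU).
rewrite [X in (X + _)%E](_ : _ = 0%E) ?add0e; last first.
  apply/eqP; rewrite eq_le measure_ge0 andbT -null.
  apply: le_measure; rewrite ?inE; [|exact: measurableD|].
    exact: measurableD.
  by move=> x [[? _] ?].
rewrite (_ : _ `&` \bigcup_i _ = \bigcup_i (part P i `&` f @^-1` A)); last first.
  apply/seteqP; split=> x /=.
    by move=> [[Ox Ax] [i _ Px]]; exists i.
  by move=> [i _ [Px Ax]]; split; [split=> //; exact: part_sub Px|exists i].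
rewrite (measure_bigcup lam setT); last 2 first.
- by move=> i _; exact: mfpart.
- apply/trivIsetP => i j _ _ ij; rewrite setIACA.
  by move/trivIsetP : tP => /(_ _ _ Logic.I Logic.I ij) ->; rewrite set0I.
under [RHS]eq_integral do rewrite total_slopeE.
rewrite integral_nneseries//.
- apply: congr_lim; apply/funext => n.
  by apply: eq_big => [i|i _]; [exact: in_setT|exact: piece_density].
- by move=> i; apply: measurable_funTS; apply/measurable_EFinP; exact: w_measurable.
Qed.

End oscillating_density.

(** * Measures, regular measures and densities on a compact set *)

Section rca_of_measure.
Context {R : realType} {d : nat}.
Local Notation V := 'rV[R]_d.
Local Notation B := (borelType V).
Variables (K : set V) (cK : compact K).

Let val_image_setC (A : set (set_type K)) : set_val @` (~` A) = K `\` (set_val @` A).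
Proof.
apply/seteqP; split=> x.
  move=> [a nA <-]; split; first exact: set_valP.
  by move=> [b Ab /val_inj ba]; apply: nA; rewrite -ba.
move=> [Kx nA]; exists (SigSub (mem_set Kx)) => // Ax; apply: nA.
by exists (SigSub (mem_set Kx)).
Qed.

Lemma measurable_val_image (A : set (set_type K)) : borel A ->
  measurable (set_val @` A : set B).
Proof.
have mK : measurable (K : set B) by exact: compact_measurable_rV.
move: A; rewrite -/(_ `<=` _); apply: smallest_sub.
  split.
  - by rewrite /= image_set0.
  - by move=> A mA; rewrite /= setTD val_image_setC; exact: measurableD.
  - by move=> A mA; rewrite /= image_bigcup; exact: bigcup_measurable.
move=> U [W oW <-] /=.
rewrite (_ : set_val @` _ = K `&` W).
  by apply: measurableI => //; exact: borel_open_measurable.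
apply/seteqP; split=> x.
  by move=> [a Wa <-]; split=> //; exact: set_valP.
by move=> [Kx Wx]; exists (SigSub (mem_set Kx)).
Qed.

(** Regularity is inherited from the ambient space, where closed and open sets
    restrict to relatively closed and relatively open ones. *)
Lemma rca_of_measure (m : {measure set B -> \bar R}) : (m setT < +oo)%E ->
  exists rho : rca R (set_type K),
    (forall A, borel A -> (rho A)%:E = m (set_val @` A)) /\
    (forall A, 0 <= rho A).
Proof.
move=> finT.
pose r (A : set (set_type K)) : R^o :=
  if `[< borel A >] then fine (m (set_val @` A)) else 0.
have fin (A : set B) : measurable A -> m A \is a fin_num.
  move=> mA; rewrite ge0_fin_numE//; apply: le_lt_trans finT.
  by apply: le_measure; rewrite ?inE.
have rE A : borel A -> (r A)%:E = m (set_val @` A).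
  by move=> bA; rewrite /r asboolT// fineK// fin//; exact: measurable_val_image.
have r0 A : 0 <= r A by rewrite /r; case: ifP => // _; exact: fine_ge0.
have r_rca : is_rca r.
  split.
  - by move=> A nA; rewrite /r asboolF.
  - move=> F bF tF.
    have bU : borel (\bigcup_n F n) by exact: sigma_algebra_bigcup.
    have mF n := measurable_val_image (bF n).
    have tF' : trivIset setT (fun n => set_val @` F n : set B).
      apply/trivIsetP => i j _ _ ij; rewrite -subset0.
      move=> _ [[a Fa <-] [b Fb /val_inj ba]].
      move/trivIsetP : tF => /(_ _ _ Logic.I Logic.I ij); rewrite -subset0.
      by apply; split; [exact: Fa|rewrite -ba].
    have mU : measurable (\bigcup_n (set_val @` F n) : set B).
      exact: bigcup_measurable.
    have := measure_semi_sigma_additive (s := m) _ mF tF' mU.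
    rewrite -image_bigcup -rE// => /fine_cvg /=.
    apply: cvg_trans; apply: near_eq_cvg; apply: nearW => n /=.
    rewrite big_mkord (eq_bigr (fun i : 'I_n => (r (F i))%:E)) ?sumEFin//.
    by move=> i _; rewrite rE.
  - move=> A e bA e0.
    have [C [U [cC oU CA AU UC]]] :=
      @finite_measure_regular R V m finT _ (measurable_val_image bA) e e0.
    have cval : continuous (set_val : set_type K -> V) by exact: initial_continuous.
    exists (set_val @^-1` C), (set_val @^-1` U); split.
    + by apply: closed_comp cC => x _; exact: cval.
    + by apply: open_comp oU => x _; exact: cval.
    + by move=> x /CA[a Aa /val_inj <-].
    + by move=> x Ax; apply: AU; exists x.
    + move=> D bD DUC; rewrite ger0_norm// -lte_fin rE//.
      apply: le_lt_trans UC; apply: le_measure; rewrite ?inE.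
      * exact: measurable_val_image.
      * apply: measurableD; first exact: borel_open_measurable.
        exact: borel_closed_measurable.
      * by move=> _ [x /DUC[Ux nCx] <-].
by exists (Rca (asboolT r_rca)).
Qed.

End rca_of_measure.

(** The deficit m2 A - m1 A is nonnegative for A and for its complement in K,
    and these two deficits add up to 0. *)
Lemma eq_measure_of_le d (T : measurableType d) (R : realType)
    (m1 m2 : {measure set T -> \bar R}) (K : set T) : measurable K ->
  (forall A, measurable A -> A `<=` K -> (m1 A <= m2 A)%E) ->
  m1 K = m2 K -> (m2 K < +oo)%E ->
  forall A, measurable A -> A `<=` K -> m1 A = m2 A.
Proof.
move=> mK m12 mKE finK A mA AK; apply/eqP; rewrite eq_le m12//=.
have mKA : measurable (K `\` A) by exact: measurableD.
have KE (m : {measure set T -> \bar R}) : m K = (m (K `\` A) + m A)%E.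
  have := measureDI m mK mA; rewrite (_ : K `&` A = A) //.
  exact/setIidPr.
have finKA : m2 (K `\` A) \is a fin_num.
  rewrite ge0_fin_numE//; apply: le_lt_trans finK; apply: le_measure.
  - by rewrite inE.
  - by rewrite inE.
  - exact: subDsetl.
rewrite -(leeD2lE _ _ finKA) -(KE m2) -mKE (KE m1) leeD2r// m12//.
Qed.

Section L1_density.
Context {R : realType} {d : nat}.
Local Notation V := 'rV[R]_d.
Local Notation B := (borelType V).
Local Notation lam := (lebesgue_rV d).

Lemma integral_lebesgue_on (K : set V) (cK : compact K) (D : set B)
    (h : B -> \bar R) : D `<=` K ->
  (\int[lebesgue_on cK]_(x in D) h x = \int[lam]_(x in D) h x)%E.
Proof.
move=> DK; apply: eq_measure_integral => A mA AD.
by rewrite /= /mrestr; congr (lam _); apply/setIidPl; exact: subset_trans DK.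
Qed.

(** An integrable function with values in the extended reals is finite almost
    everywhere, so that a real-valued function has the same integrals. *)
Lemma L1_of_integrable (K : set V) (cK : compact K) (h : B -> \bar R) :
  measurable_fun setT h -> (forall x, (0 <= h x)%E) ->
  (\int[lam]_(x in K) h x < +oo)%E ->
  exists u : L1 cK, forall D : set B, measurable D -> D `<=` K ->
    (\int[lebesgue_on cK]_(x in D) (u x)%:E = \int[lam]_(x in D) h x)%E.
Proof.
move=> mh h0 hfin.
have mK : measurable (K : set B) by exact: compact_measurable_rV.
pose v (x : B) : R := fine (h x).
have mv : measurable_fun setT v by exact: measurableT_comp.
have hi : lam.-integrable K h.
  apply/integrableP; split; first exact: measurable_funTS.
  by rewrite (eq_integral h)// => x _; rewrite gee0_abs.
have vE (D : set B) : measurable D -> D `<=` K ->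
    (\int[lam]_(x in D) (v x)%:E = \int[lam]_(x in D) h x)%E.
  move=> mD DK; apply: ae_eq_integral => //.
  - by apply: measurable_funTS; exact/measurable_EFinP.
  - exact: measurable_funTS.
  have := integrable_ae mK hi; apply: filterS => x hx Dx.
  by rewrite /v fineK// hx//; exact: DK.
pose u : B -> R := v \_ K.
have uE : EFin \o u = (EFin \o v) \_ K.
  by apply/funext => x; rewrite /u /= !patchE; case: ifP.
have uL : u \in Lfun (lebesgue_on cK) 1.
  apply/Lfun1_integrable; rewrite uE; apply/(integrable_mkcond _ mK).
  apply/integrableP; split.
    by apply: measurable_funTS; exact/measurable_EFinP.
  rewrite integral_lebesgue_on//.
  rewrite (eq_integral (fun x => (v x)%:E)); last first.
    by move=> x _; rewrite /= ger0_norm//; exact: fine_ge0.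
  by rewrite vE.
exists (Lfun_Sub (@lexx _ _ 1%E) uL) => D mD DK.
rewrite integral_lebesgue_on// -vE//; apply: eq_integral => x; rewrite inE => Dx.
by rewrite Lfun_valP /u patchE mem_set//; exact: DK.
Qed.

End L1_density.

(** * Convergence of the Young measures *)

Theorem theorem4p5 (R : realType) (d : nat) (Omega K : set 'rV[R]_d) (M : R)
    (Omega_neq0 : Omega !=set0) (Omega_bounded : bounded_set Omega)
    (Omega_open : open Omega) (M_gt0 : 0 < M)
    (Omega_M : lebesgue_rV d Omega = M%:E) (K_compact : compact K)
    (f : nat -> 'rV[R]_d -> 'rV[R]_d) (f_range : forall n, f n @` Omega `<=` K)
    (P : nat -> pieces R d)
    (f_mosc : forall n, m_oscillating Omega K (P n) (f n))
    (slope_mono : monotonic_on K (fun n => total_slope (P n))) :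
  exists rho_ : nat -> rca R (set_type K),
    (forall n, is_young_measure Omega M (f n) (rho_ n)) /\
    exists rho : rca R (set_type K),
      [/\ homogeneous_young rho,
          weakly_cvg (fun nu : rca R (set_type K) => `|nu|) rho_ rho &
          exists (u_ : nat -> L1 K_compact) (u : L1 K_compact),
            [/\ forall n, has_density (rho_ n) (u_ n),
                has_density rho u &
                weakly_cvg (@L1norm R d K K_compact) u_ u]].
Proof.
pose B := borelType 'rV[R]_d.
pose lam : {measure set B -> \bar R} := lebesgue_rV d.
have mK := compact_measurable_rV K_compact.
have mOmega := borel_open_measurable Omega_open.
have mf n : @measurable_fun _ _ B B Omega (f n) by have [] := f_mosc n.
pose nu n : {measure set B -> \bar R} := image_measure lam mOmega (mf n).
have nuD n (A : set B) : nu n A = lebesgue_rV d (Omega `&` f n @^-1` A) by [].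
clearbody nu.
have nuE n (A : set B) : measurable A ->
    nu n A = (\int[lam]_(x in A) total_slope (P n) x)%E.
  by rewrite nuD; exact: (oscillating_density Omega_open K_compact (f_mosc n)).
have nuK n : nu n K = M%:E.
  rewrite -Omega_M nuD; congr (lebesgue_rV d _).
  by apply/setIidPl => x Ox; apply: (f_range n); exists x.
have nu_le m n : (forall y, K y -> (total_slope (P m) y <= total_slope (P n) y)%E) ->
    forall A : set B, measurable A -> A `<=` K -> nu m A = nu n A.
  move=> mn; apply: (@eq_measure_of_le _ _ _ (nu m) (nu n)) => //.
  - move=> A mA AK.
    rewrite (nuE m A mA) (nuE n A mA).
    apply: ge0_le_integral.
    + exact: mA.
    + by move=> x _; exact: total_slope_ge0.
    + apply: measurable_funTS.
      exact: (measurable_total_slope (f_mosc m)).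
    + apply: measurable_funTS.
      exact: (measurable_total_slope (f_mosc n)).
    + by move=> x /AK; exact: mn.
  - by rewrite !nuK.
  - by rewrite nuK ltry.
have nu0 n (A : set B) : measurable A -> A `<=` K -> nu n A = nu 0%N A.
  case: slope_mono => mono mA AK.
    exact/esym/(nu_le 0%N n (fun y => mono 0%N n y (leq0n n)) A mA AK).
  exact: (nu_le n 0%N (fun y => mono 0%N n y (leq0n n)) A mA AK).
have Mi : 0 <= M^-1 by rewrite invr_ge0 ltW.
pose m : {measure set (borelType 'rV[R]_d) -> \bar R} := mscale (NngNum Mi) (nu 0%N).
have valK (A : set (set_type K)) : set_val @` A `<=` K.
  by move=> _ [x _ <-]; exact: set_valP.
have mT : (m setT < +oo)%E.
  by rewrite /m /= /mscale nuD preimage_setT setIT Omega_M -EFinM ltry.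
have [rho [rhoE rho0]] := rca_of_measure K_compact mT.
exists (fun=> rho); split.
  move=> n A bA; rewrite rhoE// /m /= /mscale; congr (_ * _)%E.
  by rewrite -(nu0 n) ?nuD//; exact: measurable_val_image.
exists rho; split.
- split=> //; apply/eqP; rewrite -eqe rhoE; last first.
    by apply: sub_sigma_algebra; exact: openT.
  rewrite (_ : set_val @` _ = K).
    by rewrite /m /= /mscale nuK -EFinM mulVf// gt_eqF.
  apply/seteqP; split; first exact: valK.
  by move=> x Kx; exists (SigSub (mem_set Kx)).
- by move=> phi _; exact: cvg_cst.
have [|||u uE] := @L1_of_integrable R d K K_compact
    (fun x => (M^-1)%:E * total_slope (P 0%N) x)%E.
- apply: measurable_funeM.
  exact: (measurable_total_slope (f_mosc 0%N)).
- by move=> x; rewrite mule_ge0// total_slope_ge0.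
- rewrite ge0_integralZl_EFin//.
  + by rewrite -nuE// nuK -EFinM ltry.
  + by move=> x _; exact: total_slope_ge0.
  + by apply: measurable_funTS; exact: (measurable_total_slope (f_mosc 0%N)).
have dens : has_density rho u.
  move=> A bA; have mA := measurable_val_image K_compact bA.
  rewrite rhoE// uE// ge0_integralZl_EFin//.
  + by rewrite /m /= /mscale nuE.
  + by move=> x _; exact: total_slope_ge0.
  + by apply: measurable_funTS; exact: (measurable_total_slope (f_mosc 0%N)).
exists (fun=> u), u; split=> //.
by move=> phi _; exact: cvg_cst.
Qed.
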